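(* Let $A\in\mathbb{R}^{n\times n}$ satisfy $\operatorname{Re}(z^*Az)\ge 0$ for all $z\in\mathbb{C}^n$, and let the numerical range $W(A)=\{z^*Az:z\in\mathbb{C}^n,\ z^*z=1\}$ be enclosed by an ellipse with foci $0$ and $2c$ and with the sum of semiaxes equal to $\rho c$, where $c>0$, $\rho>1$. Let $g\in\mathbb{R}^n$ with $\|g\|=1$, let $t\ge0$, let $y_k(t)=V_k\,t\,\varphi(-tH_k)e_1$ be the Krylov subspace approximation, obtained after $k$ Arnoldi steps, to $y(t)=t\varphi(-tA)g$, and let $r_k(t)=-Ay_k(t)+g-y_k'(t)$ be its residual. Then for $k\ge2$ $$\|r_k(t)\|\le 4e^{-ct}\sum_{\nu=k}^{\infty}(\nu-k+2)(\nu-k+1)\,\rho^\nu I_\nu(ct),$$ where $I_\nu$ denotes the modified Bessel function of the first kind of order $\nu$.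
   Context: $\|\cdot\|$ is the vector/matrix 2-norm. ''Enclosed by an ellipse'' means contained in the closed region of the complex plane bounded by that ellipse. $\varphi$ is the entire function $\varphi(z)=(e^z-1)/z$ for $z\ne0$, $\varphi(0)=1$, applied to matrices as a matrix function. Arnoldi process: $k$ steps of the Arnoldi process for $A$ started with $v_1=g/\|g\|$ (assumed not to break down before step $k$) produce a matrix $V_{k+1}=[v_1,\dots,v_k,v_{k+1}]\in\mathbb{R}^{n\times(k+1)}$ with orthonormal columns and an upper Hessenberg matrix $\underline{H}_k\in\mathbb{R}^{(k+1)\times k}$ such that $$AV_k=V_{k+1}\underline{H}_k=V_kH_k+h_{k+1,k}v_{k+1}e_k^T,$$ where $V_k=[v_1,\dots,v_k]$, its columns span $\mathrm{span}(g,Ag,\dots,A^{k-1}g)$, $H_k=V_k^TAV_k$ consists of the first $k$ rows of $\underline{H}_k$, $h_{k+1,k}\ge 0$ is the $(k+1,k)$ entry of $\underline{H}_k$, and $e_1,e_k$ are the first and last standard basis vectors of $\mathbb{R}^k$ (if $h_{k+1,k}=0$ the last term is zero). *)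

(* Defs.v *)
From HB Require Import structures.
From mathcomp Require Import all_boot all_order all_algebra.
From mathcomp Require Import all_classical all_reals all_analysis.
From mathcomp Require Export complex.

Set Implicit Arguments.
Unset Strict Implicit.
Unset Printing Implicit Defensive.

Import Order.TTheory GRing.Theory Num.Theory numFieldNormedType.Exports.

Local Open Scope classical_set_scope.
Local Open Scope sesquilinear_scope.
Local Open Scope complex_scope.
Local Open Scope ring_scope.

Section Vectors.
Context {R : realType}.

(* The norm `|v| that the library puts on matrices is the max norm. *)
Definition norm2 n (v : 'cV[R]_n) : R := Num.sqrt (\sum_(i < n) v i 0 ^+ 2).

Definition e1 k : 'cV[R]_k := \col_(i < k) (i == 0%N :> nat)%:R.

End Vectors.

Section NumericalRange.
Context {R : realType}.

Definition qform n (A : 'M[R]_n) (z : 'cV[R[i]]_n) : R[i] :=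
  (z ^t* *m map_mx (real_complex R) A *m z) 0 0.

Definition numrange n (A : 'M[R]_n) : set R[i] :=
  [set w | exists2 z : 'cV[R[i]]_n, z ^t* *m z = 1%:M & w = qform A z].

(* Closed region bounded by the ellipse with foci f1, f2 and major semiaxis a;
   the comparison in R[i] is between real numbers. *)
Definition ellipse_region (f1 f2 : R[i]) (a : R) : set R[i] :=
  [set z | `|z - f1| + `|z - f2| <= (2 * a)%:C].

(* a and b are the semiaxes, so a ^ 2 - b ^ 2 is the square of half the
   distance between the foci. *)
Definition enclosed_by_ellipse (W : set R[i]) (f1 f2 : R[i]) (s : R) : Prop :=
  exists a b : R,
    [/\ 0 < b <= a,
        (a ^+ 2 - b ^+ 2)%:C = (`|f2 - f1| / 2) ^+ 2,
        a + b = s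
      & W `<=` ellipse_region f1 f2 a].

End NumericalRange.

Section Functions.
Context {R : realType}.

Definition phi (x : R) : R := if x == 0 then 1 else (expR x - 1) / x.

Definition phi_coef (j : nat) : R := (j.+1)`!%:R^-1.

Lemma cvg_phi (x : R) : pseries phi_coef x @ \oo --> phi x.
Proof.
rewrite /phi; case: eqVneq => [->|x0].
  apply: cvg_near_cst; exists 1%N => // -[|m] //= _.
  rewrite /pseries seriesEnat /= big_nat_recl// expr0 mulr1 /phi_coef.
  rewrite invr1 big1 ?addr0// => i _.
  by rewrite exprS mul0r mulr0.
have -> : pseries phi_coef x =
    (fun m => (series (exp_coeff x) m.+1 - 1) / x) :> (nat -> R).
  apply/funext => m; rewrite /pseries !seriesEnat /= big_nat_recl//=.
  rewrite /exp_coeff /= expr0 divr1 addrC addKr mulr_suml.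
  apply: eq_bigr => i _.
  by rewrite /phi_coef exprS mulrAC [x * _]mulrC mulfK// mulrC.
apply: cvgMr_tmp; apply: cvgB; last exact: cvg_cst.
rewrite (cvg_shiftS (series (exp_coeff x))).
exact: is_cvg_series_exp_coeff.
Qed.

(* An entire function of a square matrix is the sum of its power series at 0
   evaluated at that matrix; see cvg_phi for the coefficients. *)
Definition phi_mx k (M : 'M[R]_k) : 'M[R]_k :=
  limn (series (fun j => phi_coef j *: M ^+ j)).

Definition besselI (nu : nat) (x : R) : R :=
  limn (series (fun m =>
    (x / 2) ^+ (2 * m + nu) / (m`! * (m + nu)`!)%:R)).

End Functions.

Section Arnoldi.
Context {R : realType}.

Definition krylov n (A : 'M[R]_n) (g : 'cV[R]_n) (k : nat) : 'M[R]_(k, n) :=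
  \matrix_(j < k) (A ^+ j *m g)^T.

(* V is V_{k+1} and H is the (k+1) x k Hessenberg matrix, so that lsubmx V is
   V_k, rsubmx V is v_{k+1}, usubmx H is H_k, and dsubmx H is the row
   h_{k+1,k} e_k^T.  When h_{k+1,k} = 0 there is no vector v_{k+1} (for
   instance if k = n), and the last column of V is left unconstrained.
   That the process does not break down before step k is the fact that the k
   orthonormal columns of V_k span the Krylov space. *)
Record arnoldi n k (A : 'M[R]_n) (g : 'cV[R]_n)
    (V : 'M[R]_(n, k + 1)) (H : 'M[R]_(k + 1, k)) : Prop := Arnoldi {
  arnoldi_start : lsubmx V *m e1 k = (norm2 g)^-1 *: g;
  arnoldi_ortho : (lsubmx V)^T *m lsubmx V = 1%:M;
  arnoldi_orthoS : dsubmx H != 0 -> V^T *m V = 1%:M;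
  arnoldi_span : ((lsubmx V)^T :=: krylov A g k)%MS;
  arnoldi_hess : forall (i : 'I_(k + 1)) (j : 'I_k), (j.+1 < i)%N -> H i j = 0;
  arnoldi_ge0 : forall j : 'I_k, j.+1 = k -> 0 <= dsubmx H 0 j;
  arnoldi_rel : A *m lsubmx V = V *m H;
  arnoldi_proj : usubmx H = (lsubmx V)^T *m A *m lsubmx V
}.

Definition krylov_approx n k (V : 'M[R]_(n, k + 1)) (H : 'M[R]_(k + 1, k))
    (t : R) : 'cV[R]_n :=
  lsubmx V *m (t *: phi_mx (- t *: usubmx H)) *m e1 k.

Definition residual n (A : 'M[R]_n) (g : 'cV[R]_n) (y : R -> 'cV[R]_n) (t : R) :
    'cV[R]_n :=
  - A *m y t + g - derive1 y t.

End Arnoldi.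

(* Main.v *)
Require Import Defs.
From HB Require Import structures.
From mathcomp Require Import all_boot all_order all_algebra.
From mathcomp Require Import all_classical all_reals all_analysis.
From mathcomp Require Import cyclic separable cyclotomic ring lra zify.
Import Order.TTheory GRing.Theory Num.Theory numFieldNormedType.Exports.

(** Write U(t) = t phi(- t H_k) e_1, so that U' = e_1 - H_k U.  The Arnoldi
    relation turns the residual of y_k = V_k U into
    - h_(k+1,k) (e_k^T U) v_(k+1), and it remains to bound h_(k+1,k) and the
    last entry of U.

    Let B = 1 - H_k / c.  Its numerical range lies in the ellipse with foci 1
    and -1 and sum of semiaxes rho, because that of 1 - A / c does and H_k is a
    compression of A.  An ellipse is an intersection of half-planes indexed by
    the circle of radius rho, and averaging the half-planes at the n-th roots
    of a point U shows that the numerical range of T_n(B) lies in the ellipse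
    of parameter rho^n (chebT_ellipse_bounded).  This is an analogue for
    Chebyshev polynomials of the power inequality for numerical radii, and it
    takes the place of the integral representations of Faber polynomials.  The
    entry of a real matrix at two orthonormal real vectors is at most the sum of
    the semiaxes of an enclosing ellipse centred at 0 with foci on the real
    axis (ellipse_bounded_orthonormal); hence
    |e_k^T T_n(B) e_1| <= rho^n for n >= 1, and h_(k+1,k) <= c rho.  Moreover
    e_k^T T_n(B) e_1 = 0 for n < k - 1, since B is upper Hessenberg.

    Next, c exp(c t) U(t) is the sum over N of (c t)^N / N! S_N e_1 where
    S_N = 1 + B + ... + B^(N-1): both sides, divided by exp(c t), solve the
    same linear system, whose solution is unique because H_k is accretive
    (phi_sol_geosum).  The geometric sum S_N is the binomial average of
    R_|N - 2m|(B), where R_n = (T_n - 1) / (X - 1) is a nonnegative combination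
    of T_0, ..., T_(n-1) (geosum_chebR).  The corner entry of R_n(B) is thus at
    most (n - k + 1) (n - k + 2) rho^(n-1), and it vanishes for n < k
    (chebR_corner).  Collecting the terms with |N - 2m| = nu produces
    2 I_nu(c t) (lim_exp_series_le).  Altogether the norm of the residual is at
    most half of the stated bound. *)

Set Implicit Arguments.
Unset Strict Implicit.
Unset Printing Implicit Defensive.
Local Open Scope complex_scope.
Local Open Scope ring_scope.

(** * Chebyshev polynomials of a matrix whose numerical range lies in an ellipse *)

Section Chebyshev.
Context {K : comNzRingType} {k : nat}.
Implicit Types B : 'M[K]_k.

(** The Chebyshev polynomial of the first kind of degree m at the matrix B.
    Matrices of arbitrary size do not form a nontrivial ring, so that the
    recursion is stated with the matrix product. *)
Fixpoint chebT B m : 'M[K]_k :=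
  match m with
  | 0 => 1%:M
  | 1 => B
  | (m'.+1 as p).+1 => 2 *: (B *m chebT B p) - chebT B m'
  end.

Lemma chebTSS B m : chebT B m.+2 = 2 *: (B *m chebT B m.+1) - chebT B m.
Proof. by []. Qed.

End Chebyshev.

Lemma map_chebT (K L : comNzRingType) (f : {rmorphism K -> L}) k (B : 'M[K]_k) m :
  map_mx f (chebT B m) = chebT (map_mx f B) m.
Proof.
elim/ltn_ind: m => -[|[|m]] IH //; first by rewrite /= map_mx1.
by rewrite !chebTSS map_mxB map_mxZ map_mxM !IH// rmorph_nat.
Qed.

Section ClosedField.
Context {C : numClosedFieldType}.
Implicit Types (u U w : C) (r : C).

Lemma prim_root_exists n : (0 < n)%N -> exists w : C, n.-primitive_root w.
Proof.
move=> n_gt0; have [s] := closed_field_poly_normal ('X^n - 1 : {poly C}).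
rewrite (monicP (monicXnsubC 1 n_gt0)) scale1r => sE.
have s_uniq : uniq s.
  by rewrite -separable_prod_XsubC -sE separable_Xn_sub_1 // pnatr_eq0 -lt0n.
have s_unity : all n.-unity_root s.
  by apply/allP => z; rewrite -root_prod_XsubC -sE.
have s_size : (n <= size s)%N.
  by rewrite -ltnS -(size_prod_XsubC s id) -sE size_XnsubC.
by have /hasP[w _ pw] := has_prim_root n_gt0 s_unity s_uniq s_size; exists w.
Qed.

(** Half of zsum u 1 is the Joukowski map at u: it sends the circle of radius r
    to the ellipse with foci 1 and -1 whose semiaxes add up to r, and it sends
    u ^+ n to the value of the Chebyshev polynomial of degree n at the image of
    u.  The complex number zdif u 1 is an outer normal of that ellipse at the
    image of u. *)
Definition zsum u l : C := u ^+ l + u ^- l.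
Definition zdif u l : C := u ^+ l - u ^- l.

Lemma zsumSS u l : u != 0 -> zsum u l.+2 = zsum u 1 * zsum u l.+1 - zsum u l.
Proof. by move=> u0; rewrite /zsum !exprS expr0; field; rewrite expf_neq0. Qed.

Lemma zdifSS u l : u != 0 -> zdif u l.+2 = zsum u 1 * zdif u l.+1 - zdif u l.
Proof. by move=> u0; rewrite /zsum /zdif !exprS expr0; field; rewrite expf_neq0. Qed.

(** The geometric sum of a power of a primitive n-th root of unity vanishes
    unless the exponent is a multiple of n: averaging over the n-th roots of
    u ^+ n keeps the term of degree n and nothing else. *)
Lemma sum_zdif_roots n w u l : n.-primitive_root w -> (0 < l <= n)%N ->
  \sum_(j < n) zdif (u * w ^+ j) l = if l == n then n%:R * zdif u n else 0.
Proof.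
move=> pw /andP[l0 ln].
have wl1 : (w ^+ l == 1) = (l == n).
  rewrite -(prim_order_dvd pw).
  apply/idP/eqP => [/dvdn_leq|->//].
  by move=> /(_ l0) nl; apply/eqP; rewrite eqn_leq ln.
have E j : zdif (u * w ^+ j) l = u ^+ l * (w ^+ l) ^+ j - u ^- l * (w ^- l) ^+ j.
  by rewrite /zdif !exprMn invfM exprVn -!exprM mulnC.
rewrite (eq_bigr _ (fun j _ => E (val j))) sumrB -!mulr_sumr.
case: eqP => [->|/eqP ln'].
  rewrite (prim_expr_order pw) invr1.
  under eq_bigr do rewrite expr1n.
  by rewrite sumr_const card_ord /zdif; ring.
have G (x : C) : x != 1 -> x ^+ n = 1 -> \sum_(j < n) x ^+ j = 0.
  move=> x1 xn; apply/eqP; have := subrX1 x n.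
  by rewrite xn subrr => /esym/eqP; rewrite mulf_eq0 subr_eq0 (negPf x1).
have wln : (w ^+ l) ^+ n = 1 by rewrite exprAC (prim_expr_order pw) expr1n.
by rewrite !G ?mulr0 ?subrr ?invr_eq1 ?wl1// exprVn wln invr1.
Qed.

Section Kernel.
Context {k : nat}.
Variable B : 'M[C]_k.

(** Up to the factor zdif u 1, this is the quotient of
    zsum u n - 2 T_n by zsum u 1 - 2 X, evaluated at B.  Written in this basis,
    its dependence on u is a combination of zdif u 1, ..., zdif u n. *)
Definition chebker u n : 'M[C]_k :=
  \sum_(m < n) ((if m == 0%N :> nat then 1 else 2) * zdif u (n - m)) *: chebT B m.

(** Here the sum for n may be extended by the term m = n, whose coefficient
    zdif u 0 vanishes, so that the three sums run over the same indices. *)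
Lemma chebkerSS u n : u != 0 ->
  chebker u n.+2 =
    zsum u 1 *: chebker u n.+1 - chebker u n + (2 * zdif u 1) *: chebT B n.+1.
Proof.
move=> u0; rewrite /chebker big_ord_recr /= subSnn; congr (_ + _).
have -> : \sum_(m < n) ((if m == 0%N :> nat then 1 else 2) * zdif u (n - m)) *: chebT B m
  = \sum_(m < n.+1) ((if m == 0%N :> nat then 1 else 2) * zdif u (n - m)) *: chebT B m.
  by rewrite big_ord_recr /= subnn /zdif expr0 invr1 subrr mulr0 scale0r addr0.
rewrite scaler_sumr -sumrB; apply: eq_bigr => m _.
have mn : (m <= n)%N by rewrite -ltnS.
rewrite scalerA -scalerBl; congr (_ *: _).
rewrite !subSn// ?(leq_trans mn)// zdifSS//.
by move: (if _ then _ else _) => e; ring.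
Qed.

Lemma chebkerP u n : u != 0 ->
  ((zsum u 1)%:M - 2 *: B) *m chebker u n =
    zdif u 1 *: ((zsum u n)%:M - 2 *: chebT B n).
Proof.
move=> u0; elim/ltn_ind: n => -[|[|n]] IH.
- by rewrite /chebker big_ord0 mulmx0 /zsum expr0 invr1 scalemx1 subrr scaler0.
- rewrite /chebker big_ord_recl big_ord0 /= addr0 mul1r subn0.
  by rewrite -scalemxAr mulmx1.
rewrite chebkerSS// !mulmxDr mulmxN -!scalemxAr !IH// zsumSS//.
rewrite chebTSS mulmxBl mul_scalar_mx -scalemxAl.
move: (B *m chebT B n.+1) => X; move: (chebT B n.+1) => Y; move: (chebT B n) => Z.
move: (zsum u 1) (zdif u 1) (zsum u n.+1) (zsum u n) => a b c d.
apply/matrixP => i j; rewrite !mxE.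
move: (X i j) (Y i j) (Z i j) => ? ? ?.
rewrite -(mulr_natr (a * c - d)) -(mulr_natr c) -(mulr_natr d).
by ring.
Qed.

End Kernel.

Local Open Scope sesquilinear_scope.

(** The numerical range of M is contained in the ellipse with foci 1 and -1 and
    sum of semiaxes r: each U on the circle of radius r gives the supporting
    half-plane at the boundary point zsum U 1 / 2, with normal zdif U 1. *)
Definition ellipse_bounded r k (M : 'M[C]_k) := forall U (x : 'cV[C]_k), `|U| = r ->
  0 <= 'Re ((zdif U 1)^* * (x^t* *m (((zsum U 1)%:M - 2 *: M) *m x)) 0 0).

Lemma zdif1_neq0 u r : 1 < r -> `|u| = r -> zdif u 1 != 0.
Proof.
move=> r1 ur; apply/eqP => /eqP; rewrite /zdif expr1 subr_eq0 => /eqP E.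
have u0 : u != 0 by rewrite -normr_gt0 ur (lt_trans ltr01).
have /(congr1 Num.norm) : u ^+ 2 = 1 by rewrite expr2 {2}E divff.
by rewrite normrX normr1 ur => /eqP; rewrite gt_eqF// exprn_egt1.
Qed.

Lemma mxC_trM m n p (X : 'M[C]_(m, n)) (Y : 'M[C]_(n, p)) :
  (X *m Y)^t* = Y^t* *m X^t*.
Proof. by rewrite trmx_mul map_mxM. Qed.

(** The elliptic form of the power inequality for numerical radii: T_n maps
    matrices with numerical range in the ellipse of parameter r to matrices with
    numerical range in the ellipse of parameter r ^ n.  Let u_j be the n-th roots
    of U, with half-planes given by zsum (u_j) 1 and zdif (u_j) 1.  The vectors
    y_j = chebker B (u_j) n x are such that zsum (u_j) 1 - 2 B sends y_j to a
    multiple of the same vector (zsum U 1 - 2 T_n B) x, and they add up to a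
    multiple of x.  So n times the form that expresses the half-plane of T_n B at
    U is a sum over j of positive multiples of the forms that express the
    half-planes of B at u_j, taken at y_j. *)
Theorem chebT_ellipse_bounded r k (B : 'M[C]_k) n : 1 < r -> (0 < n)%N ->
  ellipse_bounded r B -> ellipse_bounded (r ^+ n) (chebT B n).
Proof.
move=> r1 n0 EB U x Ur.
have [w pw] := prim_root_exists n0.
pose u0 := n.-root U; have u0U : u0 ^+ n = U by rewrite rootCK.
have r0 : 0 < r := lt_trans ltr01 r1.
have nu0 : `|u0| = r.
  apply/eqP; rewrite -(@eqrXn2 _ n)// ?(ltW r0)//.
  by rewrite -normrX u0U Ur.
have nw j : `|w ^+ j| = 1.
  have : `|w| ^+ n = 1 by rewrite -normrX (prim_expr_order pw) normr1.
  by move/eqP; rewrite pexpr_eq1// => /eqP w1; rewrite normrX w1 expr1n.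
pose uj j := u0 * w ^+ j.
have nuj j : `|uj j| = r by rewrite normrM nw nu0 mulr1.
have uj0 j : uj j != 0 by rewrite -normr_gt0 nuj.
have ujU j : uj j ^+ n = U.
  by rewrite exprMn u0U exprAC (prim_expr_order pw) expr1n mulr1.
set D := (zsum U 1)%:M - 2 *: chebT B n.
have kerj j : ((zsum (uj j) 1)%:M - 2 *: B) *m chebker B (uj j) n = zdif (uj j) 1 *: D.
  by rewrite chebkerP// /D /zsum ujU expr1.
(* only the term T_0 = 1 of the kernel survives the average over the roots *)
have sumker : \sum_(j < n) chebker B (uj j) n = (n%:R * zdif U 1)%:M.
  rewrite /chebker exchange_big /= (bigD1 (Ordinal n0))//= addrC big1 => [|m m0].
    rewrite add0r -scaler_suml.
    under eq_bigr do rewrite mul1r subn0.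
    rewrite (sum_zdif_roots _ pw) ?n0 ?leqnn// eqxx /zdif u0U expr1.
    by rewrite scalemx1.
  rewrite -scaler_suml -mulr_sumr (sum_zdif_roots _ pw); last first.
    by rewrite subn_gt0 ltn_ord leq_subr.
  have m00 : (0 < m)%N by rewrite lt0n; exact: m0.
  have /negPf -> : (n - m)%N != n by rewrite neq_ltn ltn_subrL m00 n0.
  by rewrite mulr0 scale0r.
have n0C : 0 < n%:R :> C by rewrite ltr0n.
rewrite -(pmulr_rge0 _ n0C).
have -> : n%:R * 'Re ((zdif U 1)^* * (x^t* *m (D *m x)) 0 0) =
    \sum_(j < n) 'Re ((((chebker B (uj j) n *m x)^t*) *m (D *m x)) 0 0).
  rewrite -raddf_sum -summxE -mulmx_suml.
  have -> : \sum_(j < n) (chebker B (uj j) n *m x)^t* =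
      (n%:R * (zdif U 1)^*) *: x^t*.
    rewrite -raddf_sum /= -raddf_sum /= -mulmx_suml sumker.
    rewrite mul_scalar_mx; apply/matrixP => a b.
    by rewrite !mxE rmorphM /= rmorphM /= conjC_nat.
  rewrite -scalemxAl [in RHS]mxE -mulrA /=.
  by rewrite [in RHS]ReM (Creal_ReP n%:R _)// (Creal_ImP n%:R _)// mul0r subr0.
apply: sumr_ge0 => j _; set y := chebker _ _ _ *m x.
have s0 : 0 < `|zdif (uj j) 1| ^+ 2.
  by rewrite exprn_gt0// normr_gt0 (zdif1_neq0 r1).
rewrite -(pmulr_rge0 _ s0).
have := EB (uj j) y (nuj j).
rewrite [X in _ *m X]mulmxA kerj -scalemxAl -scalemxAr [X in _ * X]mxE mulrA.
rewrite [_^* * _]mulrC -normCK ReM.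
have sR : `|zdif (uj j) 1| ^+ 2 \is Num.real by exact: rpredX (normr_real _).
by rewrite (Creal_ReP _ sR) (Creal_ImP _ sR) mul0r subr0.
Qed.
End ClosedField.

(** * Numerical ranges in an ellipse, by supporting half-planes *)

Section NumericalRange.
Context {R : realType}.
Local Open Scope sesquilinear_scope.
Notation toC := (real_complex R).

Lemma conjCE (z : R[i]) : (z^*)%R = (complex.Re z) -i* (complex.Im z).
Proof. by case: z. Qed.

Lemma ReCE (z : R[i]) : 'Re z = (complex.Re z)%:C.
Proof. by rewrite ReE ReJ_add. Qed.

(** The bifocal definition of an ellipse implies its Cartesian inequality: squaring
    twice removes the two square roots. *)
Lemma ellipse_ineq (a b f x y : R) : 0 < b -> 0 < a -> f ^+ 2 = a ^+ 2 - b ^+ 2 ->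
  Num.sqrt ((x - f) ^+ 2 + y ^+ 2) + Num.sqrt ((x + f) ^+ 2 + y ^+ 2) <= 2 * a ->
  b ^+ 2 * x ^+ 2 + a ^+ 2 * y ^+ 2 <= a ^+ 2 * b ^+ 2.
Proof.
move=> b0 a0 fE.
set p := (x - f) ^+ 2 + _; set q := (x + f) ^+ 2 + _.
have p0 : 0 <= p by rewrite addr_ge0 ?sqr_ge0.
have q0 : 0 <= q by rewrite addr_ge0 ?sqr_ge0.
have := sqr_sqrtr p0; have := sqr_sqrtr q0.
have := sqrtr_ge0 p; have := sqrtr_ge0 q.
move: (Num.sqrt p) (Num.sqrt q) => s t t0 s0 tE sE st.
(* the difference of the squared distances to the foci is 4 f x *)
have H1 : a * t <= a ^+ 2 + f * x.
  have : s ^+ 2 <= (2 * a - t) ^+ 2.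
    by rewrite ler_pXn2r ?nnegrE//; lra.
  rewrite sE sqrrB tE /p /q; nra.
have : (a * t) ^+ 2 <= (a ^+ 2 + f * x) ^+ 2.
  by rewrite ler_pXn2r ?nnegrE ?(le_trans _ H1)// mulr_ge0// ltW.
rewrite exprMn tE /q => H.
have -> : b ^+ 2 = a ^+ 2 - f ^+ 2 by rewrite fE; ring.
nra.
Qed.

Lemma sqnormC_ge0 n (z : 'cV[R[i]]_n) : 0 <= (z^t* *m z) 0 0.
Proof.
rewrite mxE; apply: sumr_ge0 => i _.
by rewrite !mxE mulrC -normCK exprn_ge0.
Qed.

Lemma sqnormC_eq0 n (z : 'cV[R[i]]_n) : (z^t* *m z) 0 0 = 0 -> z = 0.
Proof.
rewrite mxE => /eqP; rewrite psumr_eq0 => [/allP H|i _]; last first.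
  by rewrite !mxE mulrC -normCK exprn_ge0.
apply/matrixP => i j; rewrite ord1 [RHS]mxE.
have := H i (mem_index_enum i).
by rewrite !mxE mulrC -normCK expf_eq0 /= normr_eq0 => /eqP.
Qed.

Lemma conjC_real (a : R) : (a%:C : R[i])^* = a%:C.
Proof. by rewrite conjCE /= oppr0. Qed.

Lemma trC_realZ n (a : R) (z : 'cV[R[i]]_n) : (a%:C *: z)^t* = a%:C *: z^t*.
Proof. by apply/matrixP => i j; rewrite !mxE rmorphM /= conjC_real. Qed.

Lemma qformZ n (A : 'M[R]_n) (a : R) z : qform A (a%:C *: z) = (a ^+ 2)%:C * qform A z.
Proof.
rewrite /qform -scalemxAr [LHS]mxE.
by rewrite trC_realZ -!scalemxAl [X in _ * X]mxE mulrA -rmorphM expr2.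
Qed.

(** A homogeneous form of the enclosure: rescaling z to a unit vector turns a
    condition on the numerical range into one on the quadratic form at all z. *)
Lemma qform_ellipse n (A : 'M[R]_n) (c rho : R) : 0 < c -> 1 < rho ->
  enclosed_by_ellipse (numrange A) 0 (2 * c)%:C (rho * c) ->
  exists a b : R, [/\ 0 < b, 0 < a, a + b = rho * c, (a - b) * rho = c &
    forall z : 'cV[R[i]]_n,
      b ^+ 2 * (complex.Re (qform A z) - c * complex.Re ((z^t* *m z) 0 0)) ^+ 2 +
      a ^+ 2 * (complex.Im (qform A z)) ^+ 2
        <= a ^+ 2 * b ^+ 2 * complex.Re ((z^t* *m z) 0 0) ^+ 2].
Proof.
move=> c0 rho1 [a [b [/andP[b0 ba] fE abE sub]]].
have a0 : 0 < a := lt_le_trans b0 ba.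
have rho0 : 0 < rho := lt_trans ltr01 rho1.
have {}fE : a ^+ 2 - b ^+ 2 = c ^+ 2.
  apply: (@complexI R); rewrite fE subr0 normc_def /= expr0n/= addr0 sqrtr_sqr.
  rewrite gtr0_norm ?mulr_gt0// rmorphM /= (_ : 2%:C = 2); last by rewrite rmorph_nat.
  by rewrite mulrAC divff ?mul1r -?rmorphXn ?pnatr_eq0.
exists a, b; split => //.
  have : (a - b) * (rho * c) = c * c by rewrite -abE -expr2 -fE; ring.
  by rewrite mulrA => /(mulIf (lt0r_neq0 c0)).
move=> z; have N0 := sqnormC_ge0 z.
set N := complex.Re ((z^t* *m z) 0 0).
have NE : (z^t* *m z) 0 0 = N%:C by rewrite RRe_real// ger0_real.
have {N0} : 0 <= N by rewrite NE ler0c in N0.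
rewrite le_eqVlt => /predU1P[N0|N0].
  have -> : z = 0 by apply: sqnormC_eq0; rewrite NE -N0.
  by rewrite /qform mulmx0 mxE -N0 /= mulr0 subr0 expr0n /= !mulr0 addr0.
pose z' := (Num.sqrt N)^-1%:C *: z.
have sN : (Num.sqrt N)^-1 ^+ 2 = N^-1 by rewrite exprVn sqr_sqrtr// ltW.
have z'1 : z'^t* *m z' = 1%:M.
  rewrite [LHS]mx11_scalar /z' -scalemxAr [X in X%:M]mxE trC_realZ -scalemxAl.
  rewrite [X in _ * X]mxE NE; congr (_%:M).
  by rewrite mulrA -!rmorphM /= -expr2 sN mulVf// lt0r_neq0.
have := sub (qform A z') (ex_intro2 _ _ z' z'1 erefl).
rewrite qformZ sN /ellipse_region /=.
case: (qform A z) => X Y.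
rewrite !normc_def -rmorphD /= lecR.
rewrite !(mul0r, subr0, addr0, oppr0) => H.
have := @ellipse_ineq a b c (N^-1 * X - c) (N^-1 * Y) b0 a0 (esym fE).
rewrite subrK addrC (_ : _ - c - c = N^-1 * X - 2 * c); last by ring.
move=> /(_ H) {}H.
have N2 : 0 < N ^+ 2 by rewrite exprn_gt0.
rewrite -(ler_pM2r N2) in H; apply: le_trans H.
rewrite le_eqVlt; apply/orP; left; apply/eqP.
by field; rewrite lt0r_neq0.
Qed.

Lemma qform_shift n (A : 'M[R]_n) (a : R) z :
  qform (1%:M - a *: A) z = (z^t* *m z) 0 0 - a%:C * qform A z.
Proof.
rewrite /qform map_mxB map_mx1 map_mxZ mulmxBr mulmxBl mulmx1.
by rewrite -scalemxAr -scalemxAl [LHS]mxE; congr (_ + _); rewrite mxE [X in - X]mxE.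
Qed.

Lemma ellipse_formE n (M : 'M[R]_n) (s d : R[i]) z :
  d^* * (z^t* *m ((s%:M - 2 *: map_mx toC M) *m z)) 0 0 =
  d^* * (s * (z^t* *m z) 0 0 - 2 * qform M z).
Proof.
congr (_ * _); rewrite mulmxBl mul_scalar_mx -scalemxAl mulmxBr -!scalemxAr.
by rewrite mulmxA [LHS]mxE; congr (_ + _); rewrite mxE // [X in - X]mxE.
Qed.

Lemma zdif_zsum_rect (r p q : R) : 0 < r -> `|p +i* q| = r%:C ->
  [/\ p ^+ 2 + q ^+ 2 = r ^+ 2,
    zdif (p +i* q) 1 = (p - p / r ^+ 2) +i* (q + q / r ^+ 2) &
    zsum (p +i* q) 1 = (p + p / r ^+ 2) +i* (q - q / r ^+ 2)].
Proof.
move=> r0 Ur.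
have iU : (p +i* q)^-1 = (p / r ^+ 2) -i* (q / r ^+ 2).
  rewrite invc_norm Ur -rmorphXn -fmorphV /=.
  by apply/eqP; rewrite eq_complex /=; apply/andP; split; apply/eqP; ring.
split.
- by apply: (@complexI R); have := add_Re2_Im2 (p +i* q); rewrite Ur -rmorphXn.
- rewrite /zdif !expr1 iU.
  by apply/eqP; rewrite eq_complex /=; apply/andP; split; apply/eqP; ring.
- rewrite /zsum !expr1 iU.
  by apply/eqP; rewrite eq_complex /=; apply/andP; split; apply/eqP; ring.
Qed.

(** The support function of the ellipse with semiaxes a and b, by the inequality
    of Cauchy and Schwarz. *)
Lemma ellipse_support (a b x y N p q r : R) : 0 < b -> 0 < a -> 0 <= N -> 0 <= r ->
  b ^+ 2 * x ^+ 2 + a ^+ 2 * y ^+ 2 <= a ^+ 2 * b ^+ 2 * N ^+ 2 ->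
  p ^+ 2 + q ^+ 2 = r ^+ 2 ->
  b * p * x + a * q * y <= a * b * r * N.
Proof.
move=> b0 a0 N0 r0 xy pq.
apply: le_trans (ler_norm _) _.
rewrite -(@ler_pXn2r _ 2)// ?nnegrE ?mulr_ge0 ?(ltW a0) ?(ltW b0)//.
rewrite real_normK ?num_real//.
apply: (@le_trans _ _ ((p ^+ 2 + q ^+ 2) * (b ^+ 2 * x ^+ 2 + a ^+ 2 * y ^+ 2))).
  (* Lagrange identity: the defect in Cauchy-Schwarz is a square *)
  rewrite -subr_ge0 (_ : _ - _ = (p * (a * y) - q * (b * x)) ^+ 2) ?sqr_ge0//.
  by ring.
rewrite pq (_ : (_ * N) ^+ 2 = r ^+ 2 * (a ^+ 2 * b ^+ 2 * N ^+ 2)); last by ring.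
by rewrite ler_wpM2l ?sqr_ge0.
Qed.

(** The affine map z |-> 1 - z / c sends the foci 0 and 2 c to 1 and -1. *)
Lemma ellipse_bounded_shift n (A : 'M[R]_n) (c rho : R) : 0 < c -> 1 < rho ->
  enclosed_by_ellipse (numrange A) 0 (2 * c)%:C (rho * c) ->
  ellipse_bounded rho%:C (map_mx toC (1%:M - c^-1 *: A)).
Proof.
move=> c0 rho1 /(qform_ellipse c0 rho1)[a [b [b0 a0 abE baE H]]] [p q] z Ur.
have rho0 : 0 < rho := lt_trans ltr01 rho1.
have [pq -> ->] := zdif_zsum_rect rho0 Ur.
rewrite ellipse_formE qform_shift ReCE ler0c conjCE.
have N0 := sqnormC_ge0 z.
have := H z; set N := complex.Re ((z^t* *m z) 0 0).
have NE : (z^t* *m z) 0 0 = N%:C by rewrite RRe_real// ger0_real.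
rewrite NE ler0c in N0 *.
case: (qform A z) => X Y /= K.
rewrite -(sqrrN (X - _)) opprB -(sqrrN Y) in K.
have := @ellipse_support a b (c * N - X) (- Y) N p q rho b0 a0 N0 (ltW rho0) K pq.
have aE : a = c * (rho + rho^-1) / 2.
  have -> : a = ((a + b) + (a - b) * rho / rho) / 2 by field; rewrite lt0r_neq0.
  by rewrite abE baE; ring.
have bE : b = c * (rho - rho^-1) / 2.
  have -> : b = ((a + b) - (a - b) * rho / rho) / 2 by field; rewrite lt0r_neq0.
  by rewrite abE baE; ring.
have -> : a * b * rho * N = a * b * ((p ^+ 2 + q ^+ 2) / rho) * N.
  by rewrite pq; field; rewrite lt0r_neq0.
rewrite -subr_ge0 => G.
(* the half-plane is the support inequality multiplied by 4 / (c ^+ 2 * rho) *)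
have k0 : 0 < 4 / (c ^+ 2 * rho) by rewrite divr_gt0// mulr_gt0// exprn_gt0.
rewrite -(pmulr_rge0 _ k0) in G; apply: le_trans G _.
rewrite le_eqVlt; apply/orP; left; apply/eqP; rewrite aE bE.
by field; rewrite !lt0r_neq0.
Qed.

(** Compressing to a subspace shrinks the numerical range. *)
Lemma ellipse_bounded_isometry (r : R[i]) m n (M : 'M[R]_n) (V : 'M[R]_(n, m)) :
  V^T *m V = 1%:M -> ellipse_bounded r (map_mx toC M) ->
  ellipse_bounded r (map_mx toC (V^T *m M *m V)).
Proof.
move=> VV EM U z Ur.
have := EM U (map_mx toC V *m z) Ur.
rewrite !ellipse_formE /qform.
have VC : (map_mx toC V)^t* = map_mx toC V^T.
  by apply/matrixP => i j; rewrite !mxE /= conjC_real.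
have -> : (map_mx toC V *m z)^t* = z^t* *m map_mx toC V^T.
  by rewrite mxC_trM VC.
rewrite !mulmxA -(mulmxA _ (map_mx toC V^T)) -map_mxM VV map_mx1 mulmx1.
by rewrite !map_mxM !mulmxA.
Qed.

Lemma qform_rect n (M : 'M[R]_n) (u v : 'cV[R]_n) :
  let f x y := (x^T *m M *m y) 0 0 in
  qform M (map_mx toC u + 'i%C *: map_mx toC v) =
   (f u u + f v v) +i* (f u v - f v u).
Proof.
move=> f; rewrite /qform.
have -> : (map_mx toC u + 'i%C *: map_mx toC v)^t* = map_mx toC u^T - 'i%C *: map_mx toC v^T.
  apply/matrixP => i j; rewrite !mxE /=.
  rewrite rmorphD rmorphM /= !conjCE.
  by apply/eqP; rewrite eq_complex /=; apply/andP; split; apply/eqP; ring.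
rewrite mulmxDr !mulmxBl -!scalemxAr -!scalemxAl -!map_mxM.
have E x y : (map_mx toC (x^T *m M *m y)) 0 0 = (f x y)%:C by rewrite mxE.
have D (X Y : 'M[R[i]]_1) : (X + Y) 0 0 = X 0 0 + Y 0 0 by rewrite mxE.
have N (X : 'M[R[i]]_1) : (- X) 0 0 = - X 0 0 by rewrite mxE.
have S a (X : 'M[R[i]]_1) : (a *: X) 0 0 = a * X 0 0 by rewrite mxE.
rewrite !(D, N, S, E).
by apply/eqP; rewrite eq_complex /=; apply/andP; split; apply/eqP; ring.
Qed.

Lemma ellipse_bounded_rect (r : R) n (M : 'M[R]_n) (u v : 'cV[R]_n) (p q : R) :
  let f x y := (x^T *m M *m y) 0 0 in
  0 < r -> ellipse_bounded r%:C (map_mx toC M) -> p ^+ 2 + q ^+ 2 = r ^+ 2 ->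
  0 <= (p - p / r ^+ 2) * ((p + p / r ^+ 2) *
          ((u^T *m u) 0 0 + (v^T *m v) 0 0) - 2 * (f u u + f v v)) +
       (q + q / r ^+ 2) * ((q - q / r ^+ 2) *
          ((u^T *m u) 0 0 + (v^T *m v) 0 0) - 2 * (f u v - f v u)).
Proof.
move=> f r0 EM pq.
have Ur : `|p +i* q| = r%:C.
  by rewrite normc_def /= pq sqrtr_sqr gtr0_norm.
have := EM _ (map_mx toC u + 'i%C *: map_mx toC v) Ur.
have [_ -> ->] := zdif_zsum_rect r0 Ur.
rewrite ellipse_formE qform_rect -/(f u u) ReCE ler0c conjCE.
have -> : forall z : 'cV[R[i]]_n, z^t* *m z = z^t* *m map_mx toC 1%:M *m z.
  by move=> z; rewrite map_mx1 mulmx1.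
rewrite -/(qform _ _) qform_rect /= !mulmx1.
have -> : (v^T *m u) 0 0 = (u^T *m v) 0 0.
  by rewrite -[v^T *m u]trmxK mxE trmx_mul trmxK.
rewrite subrr => K; apply: le_trans K _.
rewrite le_eqVlt; apply/orP; left; apply/eqP; rewrite /f.
move: ((u^T *m u) 0 0) ((v^T *m v) 0 0) => nu nv.
move: ((u^T *m M *m u) 0 0) ((u^T *m M *m v) 0 0) => a b.
move: ((v^T *m M *m u) 0 0) ((v^T *m M *m v) 0 0) => d e.
by ring.
Qed.

(** For orthonormal real vectors u and v, the symmetric part of the form is bounded
    by the major axis and the skew part by the minor axis: the half-planes at r
    and - r, tested on u + v and u - v, bound the sum of the two off-diagonal
    entries by r + 1 / r, and the one at i r, tested on u + i v, bounds their
    difference by r - 1 / r.  Adding the two gives r, which is sharper than the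
    bound that the numerical radius alone provides. *)
Lemma ellipse_bounded_orthonormal (r : R) n (M : 'M[R]_n) (u v : 'cV[R]_n) :
  1 < r -> ellipse_bounded r%:C (map_mx toC M) ->
  u^T *m u = 1%:M -> v^T *m v = 1%:M -> u^T *m v = 0 ->
  `|(u^T *m M *m v) 0 0| <= r.
Proof.
move=> r1 EM uu vv uv.
have r0 : 0 < r := lt_trans ltr01 r1.
wlog suff H : v vv uv / (u^T *m M *m v) 0 0 <= r.
  rewrite ler_norml H// andbT lerNl.
  rewrite (_ : - _ = (u^T *m M *m - v) 0 0); last by rewrite mulmxN [RHS]mxE.
  have vN : (- v)^T = - v^T by apply/matrixP => i j; rewrite !mxE.
  by apply: H; rewrite ?vN ?mulNmx mulmxN ?opprK// uv oppr0.
have vu : v^T *m u = 0 by apply: trmx_inj; rewrite trmx_mul trmxK uv trmx0.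
pose f (x y : 'cV[R]_n) := (x^T *m M *m y) 0 0.
have tD (x y : 'cV[R]_n) : (x + y)^T = x^T + y^T by apply/matrixP => i j; rewrite !mxE.
have tN (x : 'cV[R]_n) : (- x)^T = - x^T by apply/matrixP => i j; rewrite !mxE.
have fD (x y z : 'cV[R]_n) : f x (y + z) = f x y + f x z by rewrite /f mulmxDr [LHS]mxE.
have fDl (x y z : 'cV[R]_n) : f (y + z) x = f y x + f z x.
  by rewrite /f tD !mulmxDl [LHS]mxE.
have fN (x y : 'cV[R]_n) : f x (- y) = - f x y by rewrite /f mulmxN [LHS]mxE.
have fNl (x y : 'cV[R]_n) : f (- x) y = - f x y by rewrite /f tN !mulNmx [LHS]mxE.
have f0 (x : 'cV[R]_n) : f x 0 = 0 by rewrite /f mulmx0 mxE.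
have f0l (x : 'cV[R]_n) : f 0 x = 0 by rewrite /f trmx0 !mul0mx mxE.
have n2 : ((u + v)^T *m (u + v)) 0 0 = 2 :> R.
  rewrite tD mulmxDl !mulmxDr uu vv uv vu addr0 add0r.
  by rewrite !mxE.
have n2' : ((u - v)^T *m (u - v)) 0 0 = 2 :> R.
  rewrite tD tN mulmxBl !mulmxBr uu vv uv vu subr0 sub0r opprK.
  by rewrite !mxE.
have rr : r ^+ 2 + 0 ^+ 2 = r ^+ 2 by rewrite expr0n addr0.
have rr' : (- r) ^+ 2 + 0 ^+ 2 = r ^+ 2 by rewrite sqrrN expr0n addr0.
have rr'' : 0 ^+ 2 + r ^+ 2 = r ^+ 2 by rewrite expr0n add0r.
have := ellipse_bounded_rect (u + v) 0 r0 EM rr.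
have := ellipse_bounded_rect (u - v) 0 r0 EM rr'.
have := ellipse_bounded_rect u v r0 EM rr''.
rewrite -!/(f _ _) n2 n2' uu vv mulmx0 !mxE eqxx !(fD, fDl, fN, fNl, f0, f0l).
move: (f u u) (f u v) (f v u) (f v v) => a b c d.
have -> : r / r ^+ 2 = r^-1 by field; rewrite lt0r_neq0.
rewrite mulNr (_ : r / r ^+ 2 = r^-1); last by field; rewrite lt0r_neq0.
have ri0 : 0 < r^-1 by rewrite invr_gt0.
have ri1 : 0 < r - r^-1 by rewrite subr_gt0 (lt_trans _ r1)// invf_lt1.
have ri2 : 0 < r + r^-1 by rewrite addr_gt0.
rewrite !mul0r !subrr !(addr0, add0r, mul0r, subr0) => H1 H2 H3.
have {}H1 : 0 <= (r - r^-1) - (b - c).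
  by rewrite -(pmulr_rge0 _ ri2); move: H1 => /=; lra.
have {}H3 : 0 <= (r + r^-1) - (a + c + (b + d)).
  by rewrite -(pmulr_rge0 _ ri1); move: H3; lra.
have {}H2 : 0 <= (r + r^-1) + (a + d - b - c).
  by rewrite -(pmulr_rge0 _ ri1); move: H2; lra.
lra.
Qed.

End NumericalRange.

(** * Chebyshev expansion of a geometric sum of matrices *)

Section ChebyshevSums.
Context {K : comNzRingType} {k : nat}.
Implicit Types B : 'M[K]_k.

(** For n > 0 this is n + 2 ((n - 1) T_1 + (n - 2) T_2 + ... + T_(n-1)) at B,
    the quotient of T_n - 1 by X - 1.  The recursion is the one that suits
    chebR_absz; the second differences in chebR_diff2 give the coefficients. *)
Fixpoint chebR B n : 'M[K]_k :=
  match n with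
  | 0 => 0
  | 1 => 1%:M
  | (n'.+1 as p).+1 => 2 *: (1%:M + B *m chebR B p) - chebR B n'
  end.

Lemma chebRSS B n : chebR B n.+2 = 2 *: (1%:M + B *m chebR B n.+1) - chebR B n.
Proof. by []. Qed.

Lemma chebR_diff2 B n :
  chebR B n.+2 = 2 *: chebR B n.+1 - chebR B n + 2 *: chebT B n.+1.
Proof.
elim/ltn_ind: n => -[|[|n]] IH.
- by rewrite /= mulmx1 scalerDr !subr0.
- rewrite /= subr0 -!scalemxAr mulmxDr !mulmx1.
  move: (B *m B) (1%:M : 'M[K]_k) => X I.
  by apply/matrixP => i j; rewrite !mxE; ring.
rewrite [LHS]chebRSS [in LHS](IH n.+1)// !mulmxDr mulmxN -!scalemxAr.
have -> : 2 *: (B *m chebR B n.+2) = chebR B n.+3 + chebR B n.+1 - 2 *: 1%:M.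
  by rewrite (chebRSS _ n.+1) scalerDr subrK addrAC subrr add0r.
have -> : 2 *: (B *m chebT B n.+2) = chebT B n.+3 + chebT B n.+1.
  by rewrite (chebTSS _ n.+1) subrK.
have E : 2 *: (B *m chebR B n.+1) = chebR B n.+2 + chebR B n - 2 *: 1%:M.
  by rewrite chebRSS scalerDr subrK addrAC subrr add0r.
rewrite !scalerDr !scalerN E (IH n)//.
move: (chebR B n.+3) (chebR B n.+1) (chebR B n) => r3 r1 r0.
move: (chebT B n.+3) (chebT B n.+1) (1%:M : 'M[K]_k) => t3 t1 I.
by apply/matrixP => i j; rewrite !mxE; ring.
Qed.

Definition geosum B N : 'M[K]_k := iter N (fun X => 1%:M + B *m X) 0.

(** Pascal's rule, in the form of one step of a simple random walk. *)
Lemma sum_binS (V : lmodType K) N (g : nat -> V) :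
  \sum_(m < N.+2) 'C(N.+1, m)%:R *: g m =
  \sum_(m < N.+1) 'C(N, m)%:R *: (g m + g m.+1).
Proof.
rewrite big_ord_recl bin0 /=.
under eq_bigr do rewrite /bump add1n binS natrD scalerDl.
under [RHS]eq_bigr do rewrite scalerDr.
rewrite !big_split /= addrA; congr (_ + _).
rewrite [in RHS]big_ord_recl /= bin0; congr (_ + _).
by rewrite big_ord_recr /= bin_small// scale0r addr0.
Qed.

(** The recursion of chebR, extended to all integers by parity: this is what
    makes the binomial formula for geosum free of boundary terms. *)
Lemma chebR_absz B (z : int) :
  2 *: (1%:M + B *m chebR B (absz z)) = chebR B (absz (z + 1)) + chebR B (absz (z - 1)).
Proof.
wlog z0 : z / 0 <= z.
  move=> H; have [/H//|z0] := leP 0 z.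
  have := H (- z); rewrite abszN => -> //; last by lia.
  by rewrite [LHS]addrC; congr (chebR B _ + chebR B _); lia.
case: z z0 => // -[|n] _.
  by rewrite /= mulmx0 addr0 scaler_nat mulr2n.
transitivity (chebR B n.+2 + chebR B n); first by rewrite chebRSS subrK.
by congr (chebR B _ + chebR B _); lia.
Qed.

(** This is (1 - X^N) / (1 - X) with X^N expanded in Chebyshev polynomials: if
    X = (w + 1/w) / 2 then X^N is the binomial average of T_|N - 2m|, and chebR is
    T_n - 1 divided by X - 1.  The proof compares the recursion
    S_(N+1) = 1 + B S_N with Pascal's rule. *)
Lemma geosum_chebR B N :
  2 ^+ N *: geosum B N =
  \sum_(m < N.+1) 'C(N, m)%:R *: chebR B (absz (Posz N - Posz (2 * m))).
Proof.
elim: N => [|N IH].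
  by rewrite /geosum big_ord_recl big_ord0 addr0 muln0 subrr /= !scaler0.
rewrite (sum_binS N (fun m => chebR B (absz (Posz N.+1 - Posz (2 * m))))).
rewrite exprS -scalerA [geosum B N.+1]/= -/(geosum B N) scalerDr scalemxAr IH.
have -> : 2 ^+ N *: 1%:M = \sum_(m < N.+1) 'C(N, m)%:R *: (1%:M : 'M[K]_k).
  rewrite -scaler_suml -natr_sum -natrX; congr (_%:R *: _).
  have := expnDn 1 1 N; rewrite addn1 => ->.
  by apply: eq_bigr => i _; rewrite !exp1n !muln1.
rewrite mulmx_sumr -big_split /= scaler_sumr; apply: eq_bigr => m _.
rewrite -scalemxAr -scalerDr scalerA mulrC -scalerA; congr (_ *: _).
rewrite chebR_absz; congr (chebR B _ + chebR B _); lia.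
Qed.

End ChebyshevSums.

(** * Corner entries of Chebyshev sums of a Hessenberg matrix *)

Section Hessenberg.
Context {K : comNzRingType} {k : nat}.
Implicit Types B : 'M[K]_k.

(** Upper Hessenberg matrices are the case d = 1, polynomials of degree d in them
    the general one. *)
Definition band (d : nat) (M : 'M[K]_k) :=
  forall i j : 'I_k, (j + d < i)%N -> M i j = 0.

Lemma bandM d d' M N : band d M -> band d' N -> band (d + d') (M *m N).
Proof.
move=> bM bN i j ij; rewrite mxE big1// => l _.
have [li|li] := ltnP (l + d) i; first by rewrite bM// mul0r.
by rewrite bN ?mulr0//; lia.
Qed.

Lemma band_chebT B n : band 1 B -> band n (chebT B n).
Proof.
move=> bB; elim/ltn_ind: n => -[|[|n]] IH //.
  move=> i j; rewrite addn0 => ij; rewrite mxE; case: eqP => // E.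
  by rewrite E ltnn in ij.
move=> i j ij; rewrite chebTSS !mxE.
have := bandM bB (IH n.+1 (ltnSn _)) (i := i) (j := j); rewrite mxE => ->; last by lia.
by rewrite (IH n)// ?mulr0 ?subrr//; lia.
Qed.

End Hessenberg.

Section ChebyshevBound.
Context {R : realFieldType} {k : nat}.
Implicit Types B : 'M[R]_k.

(** The weights of the Bessel functions in the final bound.  The test is needed
    since n - k is truncated: the product would not vanish for n < k. *)
Definition cheb_weight (k : nat) (rho : R) (n : nat) : R :=
  if (n < k)%N then 0 else ((n - k + 2) * (n - k + 1))%:R * rho ^+ n.

(** The corner entry of T_j vanishes for j < k - 1 and is at most rho ^ j
    otherwise.  It is half the second difference of the corner entries of chebR,
    so that summing twice gives a quadratic factor times the largest power. *)
Lemma chebR_corner B (i0 il : 'I_k) (rho : R) :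
  band 1 B -> i0 = 0%N :> nat -> il.+1 = k -> (0 < il)%N -> 1 <= rho ->
  (forall n, (0 < n)%N -> `|chebT B n il i0| <= rho ^+ n) ->
  forall n, `|chebR B n il i0| * rho <= cheb_weight k rho n.
Proof.
move=> bB i00 ilk il0 rho1 bT.
have rho0 : 0 < rho := lt_le_trans ltr01 rho1.
have r2 n : chebR B n.+2 il i0 =
    2 * chebR B n.+1 il i0 - chebR B n il i0 + 2 * chebT B n.+1 il i0.
  by rewrite chebR_diff2 !mxE.
have t0 n : (n < il)%N -> chebT B n il i0 = 0.
  by move=> nil; apply: (band_chebT bB); rewrite i00.
have z n : (n <= il)%N -> chebR B n il i0 = 0.
  elim/ltn_ind: n => -[|[|n]] IH nl; first by rewrite mxE.
    by rewrite /= (t0 0%N).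
  by rewrite r2 !IH ?t0 ?mulr0 ?subrr ?addr0//; lia.
(* with il = k - 1: first differences grow linearly, values quadratically *)
have H d : `|chebR B (il + d).+1 il i0 - chebR B (il + d) il i0|
        <= (2 * d.+1)%:R * rho ^+ (il + d) /\
      `|chebR B (il + d) il i0| * rho <= (d * d.+1)%:R * rho ^+ (il + d).
  elim: d => [|d [IH1 IH2]].
    rewrite addn0 (z il)// normr0 !mul0r subr0; split => //.
    have lE : il.-1.+1 = il by rewrite prednK.
    have := r2 il.-1; rewrite lE => ->.
    rewrite (z il)// (z il.-1); last by lia.
    by rewrite mulr0 subr0 add0r normrM gtr0_norm// muln1 ler_wpM2l// bT.
  rewrite addnS r2.
  have := bT (il + d).+1 isT; rewrite exprS.
  have : 0 < rho ^+ (il + d) by rewrite exprn_gt0.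
  move: IH1 IH2; move: (chebR B (il + d).+1 il i0) (chebR B (il + d) il i0).
  move: (rho ^+ (il + d)) (chebT B (il + d).+1 il i0) => P T b a Hba Ha P0 HT.
  have d0 : 0 <= d%:R :> R by rewrite ler0n.
  have PP : P <= rho * P by rewrite ler_peMl// ltW.
  split.
    have -> : 2 * b - a + 2 * T - b = (b - a) + 2 * T by ring.
    apply: le_trans (ler_normD _ _) _.
    rewrite normrM (gtr0_norm (ltr0n _ 2)).
    apply: (le_trans (lerD Hba (ler_wpM2l _ HT))) => //.
    have -> : (2 * d.+2)%:R = (2 * d.+1)%:R + 2 :> R by rewrite -natrD; congr _%:R; lia.
    by rewrite [leRHS]mulrDl lerD2r ler_wpM2l.
  have -> : b = a + (b - a) by ring.
  apply: le_trans (ler_wpM2r (ltW rho0) (ler_normD _ _)) _.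
  rewrite mulrDl; apply: (le_trans (lerD Ha (ler_wpM2r (ltW rho0) Hba))).
  have -> : (d.+1 * d.+2)%:R = (d * d.+1)%:R + (2 * d.+1)%:R :> R.
    by rewrite -natrD; congr _%:R; lia.
  by rewrite [leRHS]mulrDl lerD ?ler_wpM2l// -mulrA (mulrC P).
move=> n; rewrite /cheb_weight; case: ltnP => nk.
  by rewrite z ?normr0 ?mul0r//; lia.
have iln : (il <= n)%N by rewrite -ltnS ilk leqW.
have [_] := H (n - il)%N; rewrite subnKC// => HH; apply: le_trans HH _.
rewrite le_eqVlt; apply/orP; left; apply/eqP.
have -> : (n - il = n - k + 1)%N by lia.
by rewrite mulnC -addnS.
Qed.

Lemma geosum_corner B (i0 il : 'I_k) (rho : R) N :
  band 1 B -> i0 = 0%N :> nat -> il.+1 = k -> (0 < il)%N -> 1 <= rho ->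
  (forall n, (0 < n)%N -> `|chebT B n il i0| <= rho ^+ n) ->
  `|geosum B N il i0| * rho <=
    2^-N * \sum_(m < N.+1) 'C(N, m)%:R * cheb_weight k rho (absz (Posz N - Posz (2 * m))).
Proof.
move=> bB i00 ilk il0 rho1 bT.
have rho0 : 0 < rho := lt_le_trans ltr01 rho1.
rewrite -(ler_pM2l (_ : 0 < 2 ^+ N)) ?exprn_gt0// mulVKf ?expf_neq0 ?pnatr_eq0//.
rewrite mulrA -[2 ^+ N]gtr0_norm ?exprn_gt0// -normrM.
have -> : 2 ^+ N * geosum B N il i0 = (2 ^+ N *: geosum B N) il i0 by rewrite mxE.
rewrite geosum_chebR summxE.
apply: le_trans (ler_wpM2r (ltW rho0) (ler_norm_sum _ _ _)) _.
rewrite mulr_suml; apply: ler_sum => m _.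
rewrite mxE normrM normr_nat -mulrA ler_wpM2l ?ler0n//.
exact: chebR_corner.
Qed.

End ChebyshevBound.

(** * Comparison with series of modified Bessel functions *)

Section Bessel.
Context {R : realType}.
Implicit Types (x tau rho : R) (w : nat -> R).

Definition bessel_term (nu : nat) x (m : nat) : R :=
  (x / 2) ^+ (2 * m + nu) / (m`! * (m + nu)`!)%:R.

Lemma bessel_term_ge0 nu x m : 0 <= x -> 0 <= bessel_term nu x m.
Proof. by move=> x0; rewrite divr_ge0// exprn_ge0// divr_ge0. Qed.

Lemma is_cvg_bessel nu x : 0 <= x -> cvgn (series (bessel_term nu x)).
Proof.
move=> x0.
have h0 : 0 <= x / 2 by rewrite divr_ge0.
pose e : R^nat := (x / 2) ^+ nu *: exp_coeff ((x / 2) ^+ 2).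
apply: (@series_le_cvg _ _ e).
- by move=> m; exact: bessel_term_ge0.
- by move=> m; rewrite /e /= mulr_ge0 ?exprn_ge0// divr_ge0// exprn_ge0// exprn_ge0.
- move=> m; rewrite /e /exp_coeff /bessel_term /= exprD exprM mulrAC [leRHS]mulrC.
  rewrite ler_wpM2r ?exprn_ge0// ler_wpM2l ?exprn_ge0//.
  by rewrite lef_pV2 ?posrE ?ltr0n ?muln_gt0 ?fact_gt0// ler_nat leq_pmulr// fact_gt0.
- exact: is_cvg_seriesZ (is_cvg_series_exp_coeff _).
Qed.

(** The terms m and N - m of the symmetric sum coincide, hence the factor 2. *)
Lemma sum_binom_abs_le w N : (forall n, 0 <= w n) ->
  \sum_(m < N.+1) 'C(N, m)%:R * w (absz (Posz N - Posz (2 * m))) <=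
  2 * \sum_(m < N.+1 | (2 * m <= N)%N) 'C(N, m)%:R * w (N - 2 * m)%N.
Proof.
move=> w0; rewrite (bigID (fun m : 'I_N.+1 => (2 * m <= N)%N)) /= mulr_natl mulr2n.
apply: lerD.
  apply: ler_sum => m mN; rewrite le_eqVlt; apply/orP; left; apply/eqP.
  by congr (_ * w _); lia.
rewrite (reindex_inj rev_ord_inj) /=.
apply: le_trans (_ : \sum_(m < N.+1 | (2 * m < N)%N) 'C(N, m)%:R * w (N - 2 * m)%N <= _).
  rewrite le_eqVlt; apply/orP; left; apply/eqP.
  apply: eq_big => [m|m mN]; first by have := ltn_ord m; lia.
  have mN' : (m <= N)%N by rewrite -ltnS.
  by rewrite subSS bin_sub//; congr (_ * w _); lia.
rewrite [leRHS](bigID (fun m : 'I_N.+1 => (2 * m < N)%N)) /=.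
rewrite -[leLHS]addr0; apply: lerD; last by rewrite sumr_ge0// => m _; rewrite mulr_ge0.
rewrite le_eqVlt; apply/orP; left; apply/eqP; apply: eq_bigl => m; lia.
Qed.

Lemma sum_shift_le (f : nat -> R) a P : (forall n, 0 <= f n) ->
  \sum_(i < P | (a <= i)%N) f (i - a)%N <= \sum_(i < P) f i.
Proof.
move=> f0; rewrite -(big_mkord (fun i => (a <= i)%N) (fun i => f (i - a)%N)).
rewrite -(big_mkord xpredT f).
have [Pa|aP] := leqP P a.
  rewrite big_nat_cond big1 ?sumr_ge0// => i /andP[/andP[_ iP] ai].
  by move: (leq_ltn_trans (leq_trans Pa ai) iP); rewrite ltnn.
rewrite (big_cat_nat _ (n := a))//=; last exact: ltnW.
rewrite [X in X + _]big_nat_cond big1 ?add0r; last first.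
  by move=> i /andP[/andP[_ ia] ai]; move: (leq_ltn_trans ai ia); rewrite ltnn.
rewrite -{1}[a]add0n big_addn.
rewrite (eq_big (fun=> true) f); [|by move=> i; rewrite leq_addl|by move=> i _; rewrite addnK].
rewrite [leRHS](big_cat_nat _ (n := (P - a)%N))//= ?leq_subr//.
by rewrite lerDl sumr_ge0.
Qed.

Lemma bessel_partial_le nu x P : 0 <= x -> \sum_(m < P) bessel_term nu x m <= besselI nu x.
Proof.
move=> x0.
have H : nondecreasing_seq (series (bessel_term nu x)).
  by apply: nondecreasing_series => m _ _; exact: bessel_term_ge0.
have := nondecreasing_cvgn_le H (@is_cvg_bessel nu x x0) P; rewrite {1}seriesEord /=. exact.
Qed.

Lemma besselI_ge0 nu x : 0 <= x -> 0 <= besselI nu x.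
Proof. by move=> x0; have := bessel_partial_le nu 0 x0; rewrite big_ord0. Qed.

(** Summing over N = 2 m + nu with nu fixed produces the series of besselI nu.
    Since all terms are nonnegative, a triangle of indices may be compared with
    the square that contains it, and no interchange of limits occurs. *)
Lemma sum_exp_binom_le w x P : (forall n, 0 <= w n) -> 0 <= x ->
  \sum_(N < P) x ^+ N / N`!%:R *
     (2^-N * \sum_(m < N.+1) 'C(N, m)%:R * w (absz (Posz N - Posz (2 * m)))) <=
  2 * \sum_(nu < P) w nu * besselI nu x.
Proof.
move=> w0 x0.
apply: (@le_trans _ _ (\sum_(N < P) 2 * \sum_(m < P | (2 * m <= N)%N)
    bessel_term (N - 2 * m) x m * w (N - 2 * m)%N)).
  apply: ler_sum => N _.
  rewrite mulrA; apply: le_trans (ler_wpM2l _ (sum_binom_abs_le N w0)) _.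
    by rewrite !mulr_ge0 ?invr_ge0 ?exprn_ge0// invr_ge0.
  rewrite mulrCA ler_wpM2l// mulr_sumr.
  rewrite (big_ord_widen_cond P (fun m => (2 * m <= N)%N) (fun m =>
    x ^+ N / N`!%:R * 2 ^- N * ('C(N, m)%:R * w (N - 2 * m)%N)))//.
  rewrite le_eqVlt; apply/orP; left; apply/eqP; apply: eq_big.
    by move=> m; lia.
  move=> m /andP[mN mN'].
  rewrite mulrA; congr (_ * _); rewrite /bessel_term subnKC// expr_div_n.
  have -> : (m + (N - 2 * m) = N - m)%N by lia.
  rewrite -(bin_fact (_ : m <= N)%N) ?natrM; last by lia.
  have H n : n`!%:R != 0 :> R by rewrite pnatr_eq0 -lt0n fact_gt0.
  have Hb : 'C(N, m)%:R != 0 :> R by rewrite pnatr_eq0 -lt0n bin_gt0; lia.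
  by field; rewrite !H Hb expf_neq0.
rewrite -mulr_sumr ler_wpM2l//.
rewrite (exchange_big_dep xpredT)//=.
apply: (@le_trans _ _ (\sum_(m < P) \sum_(nu < P) bessel_term nu x m * w nu)).
  apply: ler_sum => m _.
  have f0 nu : 0 <= bessel_term nu x m * w nu by rewrite mulr_ge0 ?bessel_term_ge0.
  exact: (@sum_shift_le (fun nu => bessel_term nu x m * w nu) (2 * m)%N P f0).
rewrite exchange_big /=; apply: ler_sum => nu _.
by rewrite -mulr_suml mulrC ler_wpM2l// bessel_partial_le.
Qed.

Lemma lim_exp_series_le k rho x (a : nat -> R) : 0 < rho -> 0 <= x ->
  (forall N, `|a N| * rho <=
     2^-N * \sum_(m < N.+1) 'C(N, m)%:R * cheb_weight k rho (absz (Posz N - Posz (2 * m)))) ->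
  cvgn (series (fun N => x ^+ N / N`!%:R * a N)) ->
  ((`|limn (series (fun N => x ^+ N / N`!%:R * a N))| * rho)%:E <=
   2%:E * \sum_(k <= nu <oo)
     (((nu - k + 2) * (nu - k + 1))%:R * rho ^+ nu * besselI nu x)%:E)%E.
Proof.
move=> rho0 x0 aw ca.
pose t nu := ((nu - k + 2) * (nu - k + 1))%:R * rho ^+ nu * besselI nu x.
have t0 nu : 0 <= t nu by rewrite !mulr_ge0 ?exprn_ge0 ?(ltW rho0) ?besselI_ge0.
have w0 n : 0 <= cheb_weight k rho n.
  by rewrite /cheb_weight; case: ifP => // _; rewrite mulr_ge0 ?exprn_ge0 ?ltW.
set S := (\sum_(k <= nu <oo) _)%E.
have PS P : ((\sum_(nu < P) cheb_weight k rho nu * besselI nu x)%:E <= S)%E.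
  apply: le_trans (nneseries_lim_ge P _); last by move=> nu _ _; rewrite lee_fin t0.
  rewrite sumEFin lee_fin -(big_mkord xpredT (fun nu => cheb_weight k rho nu * besselI nu x)).
  rewrite (bigID (fun nu => (nu < k)%N)) /= big1 ?add0r; last first.
    by move=> nu nk; rewrite /cheb_weight nk mul0r.
  rewrite big_mkord big_geq_mkord le_eqVlt; apply/orP; left; apply/eqP.
  apply: eq_big => [nu|nu]; first by rewrite -leqNgt.
  by rewrite /cheb_weight => /negPf ->.
have S0 : (0 <= S)%E by apply: nneseries_ge0 => nu _ _; rewrite lee_fin t0.
(* the bound is trivial when the Bessel series diverges *)
case: S S0 PS => [s s0 PS|_ _|//]; last by rewrite gt0_muley ?leey// lte_fin.
rewrite lee_fin -ler_pdivlMr//.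
apply: (cvgr_to_le (cvg_norm ca)).
near=> P; rewrite ler_pdivlMr// seriesEord /=.
apply: le_trans (ler_wpM2r (ltW rho0) (ler_norm_sum _ _ _)) _.
rewrite mulr_suml.
have := PS P; rewrite lee_fin => PsS.
apply: le_trans (ler_wpM2l _ PsS) => //.
apply: le_trans (sum_exp_binom_le P w0 x0).
apply: ler_sum => N _; rewrite normrM -mulrA ger0_norm ?ler_wpM2l//.
  by rewrite divr_ge0// exprn_ge0.
by rewrite divr_ge0// exprn_ge0.
Unshelve. all: by end_near. Qed.

End Bessel.

(** * Exponential generating series *)

Section ExpSeries.
Context {R : realType}.
Implicit Types (a : nat -> R) (t : R).

(** The exponential generating function of a: differentiating it shifts a. *)
Definition expser a t : R := limn (series (fun N => t ^+ N / N`!%:R * a N)).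

Definition expgrowth a := exists K b : R, forall N, `|a N| <= K * b ^+ N.

Lemma expgrowth_shift a : expgrowth a -> expgrowth (fun N => a N.+1).
Proof.
by move=> [K [b H]]; exists (K * b), b => N; have := H N.+1; rewrite exprS mulrA.
Qed.

Lemma is_cvg_expser a t : expgrowth a -> cvgn (series (fun N => t ^+ N / N`!%:R * a N)).
Proof.
move=> [K [b H]]; apply: normed_cvg.
pose e N : R := `|K| * exp_coeff `|t * b| N.
apply: (@series_le_cvg _ _ e) => [N|N|N|]; first by rewrite /= normr_ge0.
- by rewrite /e mulr_ge0// exp_coeff_ge0.
- have -> : e N = `|t| ^+ N / N`!%:R * (`|K| * `|b| ^+ N).
    by rewrite /e /exp_coeff /= normrM exprMn; ring.
  rewrite /= normrM normrM normfV normr_nat normrX ler_wpM2l//.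
  by apply: le_trans (H N) _; apply: le_trans (ler_norm _) _; rewrite normrM normrX.
- exact: is_cvg_seriesZ (is_cvg_series_exp_coeff _).
Qed.

Lemma is_derive_expser a t : expgrowth a ->
  is_derive t (1 : R) (expser a) (expser (fun N => a N.+1) t).
Proof.
move=> ga.
pose c N := a N / N`!%:R.
have E b x : series (fun N => x ^+ N / N`!%:R * b N) = pseries (fun N => b N / N`!%:R) x.
  congr (series _); apply/funext => N /=; ring.
have dc : pseries_diffs c = fun N => a N.+1 / N`!%:R.
  apply/funext => N; rewrite /pseries_diffs /c factS natrM.
  by rewrite invfM mulrCA mulVKf ?pnatr_eq0.
have ddc : pseries_diffs (pseries_diffs c) = fun N => a N.+2 / N`!%:R.
  rewrite dc; apply/funext => N; rewrite /pseries_diffs factS natrM.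
  by rewrite invfM mulrCA mulVKf ?pnatr_eq0.
have g1 := expgrowth_shift ga; have g2 := expgrowth_shift g1.
(* the series converge everywhere; any radius beyond |t| will do *)
have K : `|t| < `| `|t| + 1 |.
  by rewrite [ltRHS]ger0_norm ?addr_ge0// ltrDl.
have := @pseries_snd_diffs R c (`|t| + 1) t.
rewrite ddc dc -!E.
move=> /(_ (@is_cvg_expser _ _ ga) (@is_cvg_expser _ _ g1) (@is_cvg_expser _ _ g2) K).
by rewrite (_ : (fun x => limn (pseries c x)) = expser a)//; apply/funext => x; rewrite /expser E.
Qed.

Lemma expserD a b t : expgrowth a -> expgrowth b ->
  expser (fun N => a N + b N) t = expser a t + expser b t.
Proof.
move=> ga gb; rewrite /expser -limD; [|exact: is_cvg_expser|exact: is_cvg_expser].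
by rewrite -seriesD; congr (limn (series _)); apply/funext => N /=; rewrite mulrDr.
Qed.

Lemma expserZ a (c : R) t : expgrowth a ->
  expser (fun N => c * a N) t = c * expser a t.
Proof.
move=> ga; have H := @is_cvg_expser _ t ga.
transitivity (limn (series (c *: (fun N => t ^+ N / N`!%:R * a N)))).
  by congr (limn (series _)); apply/funext => N /=; rewrite mulrCA.
by rewrite lim_seriesZ.
Qed.

Lemma expser_exp (c : R) t : expser (fun N => c ^+ N) t = expR (t * c).
Proof.
by congr (limn (series _)); apply/funext => N; rewrite /exp_coeff /= exprMn mulrAC.
Qed.

Lemma expser_delta (d : R) t : expser (fun N => if N is 0 then d else 0) t = d.
Proof.
apply: cvg_lim => //; apply: cvg_near_cst; exists 1%N => // -[|m] //= _.
rewrite seriesEnat /= big_nat_recl// expr0 invr1 !mul1r big1 ?addr0// => i _.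
by rewrite mulr0.
Qed.

Lemma expgrowthD a b : expgrowth a -> expgrowth b -> expgrowth (fun N => a N + b N).
Proof.
move=> [K [q H]] [K' [q' H']].
exists (`|K| + `|K'|), (`|q| + `|q'|) => N.
apply: le_trans (ler_normD _ _) _; rewrite mulrDl; apply: lerD.
- apply: le_trans (H N) _; apply: le_trans (ler_norm _) _.
  by rewrite normrM normrX ler_wpM2l// lerXn2r ?nnegrE ?addr_ge0// lerDl.
- apply: le_trans (H' N) _; apply: le_trans (ler_norm _) _.
  by rewrite normrM normrX ler_wpM2l// lerXn2r ?nnegrE ?addr_ge0// lerDr.
Qed.

Lemma expgrowthZ a (d : R) : expgrowth a -> expgrowth (fun N => d * a N).
Proof.
by move=> [K [q H]]; exists (`|d| * K), q => N; rewrite normrM -mulrA ler_wpM2l.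
Qed.

Lemma expgrowth_sum n (a : 'I_n -> nat -> R) : (forall i, expgrowth (a i)) ->
  expgrowth (fun N => \sum_(i < n) a i N).
Proof.
elim: n a => [|n IH] a ga.
  by exists 0, 0 => N; rewrite big_ord0 normr0 mul0r.
rewrite (_ : (fun N => _) = fun N => \sum_(i < n) a (widen_ord (leqnSn n) i) N + a ord_max N).
  by apply: expgrowthD => //; exact: IH.
by apply/funext => N; rewrite big_ord_recr.
Qed.

Lemma expser_sum n (a : 'I_n -> nat -> R) t : (forall i, expgrowth (a i)) ->
  expser (fun N => \sum_(i < n) a i N) t = \sum_(i < n) expser (a i) t.
Proof.
elim: n a => [|n IH] a ga.
  rewrite big_ord0 -[RHS](expser_delta 0 t); congr expser; apply/funext => -[|N];
    by rewrite big_ord0.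
rewrite big_ord_recr /= -IH// -(@expserD _ _ t)//; last exact: expgrowth_sum.
by congr expser; apply/funext => N; rewrite big_ord_recr.
Qed.

End ExpSeries.

(** * The phi function of a matrix as an exponential generating series *)

Section MatrixSeries.
Context {R : realType}.
Implicit Types (t : R).
Local Open Scope classical_set_scope.

Lemma cvg_mx m n (X : nat -> 'M[R]_(m, n)) (L : 'M[R]_(m, n)) :
  (forall i j, (fun N => X N i j) @ \oo --> L i j) -> X @ \oo --> L.
Proof.
move=> H A [P HP sub].
have : \forall N \near \oo, forall i j, P i j (X N i j).
  apply: filter_forall => i; apply: filter_forall => j; exact: H (HP i j).
by apply: filterS => N; exact: sub.
Qed.

Definition entry_sum k (M : 'M[R]_k) : R := \sum_i \sum_j `|M i j|.

Lemma mulmx_entry_le k p (M : 'M[R]_k) (X : 'M[R]_(k, p)) (D : R) : 0 <= D ->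
  (forall i j, `|X i j| <= D) -> forall i j, `|(M *m X) i j| <= entry_sum M * D.
Proof.
move=> D0 XD i j; rewrite mxE; apply: le_trans (ler_norm_sum _ _ _) _.
apply: (@le_trans _ _ (\sum_l `|M i l| * D)).
  by apply: ler_sum => l _; rewrite normrM ler_wpM2l.
rewrite -mulr_suml ler_wpM2r// /entry_sum [leRHS](bigD1 i)//= lerDl.
by rewrite sumr_ge0// => l _; rewrite sumr_ge0.
Qed.

Lemma entry_sum_ge0 k (M : 'M[R]_k) : 0 <= entry_sum M.
Proof. by rewrite sumr_ge0// => i _; rewrite sumr_ge0. Qed.

Lemma expgrowth_mxX k (M : 'M[R]_k) i j : expgrowth (fun N => (M ^+ N) i j).
Proof.
exists 1, (entry_sum M) => N; rewrite mul1r; elim: N i j => [|N IH] i j.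
  by rewrite !expr0 mxE; case: (_ == _); rewrite ?normr1 ?normr0.
rewrite !exprS; apply: mulmx_entry_le => //.
by rewrite exprn_ge0// entry_sum_ge0.
Qed.

Lemma expgrowth_geosum k (M : 'M[R]_k) i j : expgrowth (fun N => geosum M N i j).
Proof.
have M0 := entry_sum_ge0 M.
exists 1, (entry_sum M + 1) => N; rewrite mul1r; elim: N i j => [|N IH] i j.
  by rewrite expr0 mxE normr0.
rewrite /= -/(geosum M N) mxE; apply: le_trans (ler_normD _ _) _.
rewrite exprS mulrDl mul1r addrC; apply: lerD.
  by apply: mulmx_entry_le => //; rewrite exprn_ge0// addr_ge0.
apply: (@le_trans _ _ 1); last by rewrite exprn_ege1// lerDr.
by rewrite mxE; case: (_ == _); rewrite ?normr1 ?normr0.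
Qed.

Lemma expgrowth_divS (b : nat -> R) : expgrowth b -> expgrowth (fun l => b l / l.+1%:R).
Proof.
move=> [K [q H]]; exists K, q => N; apply: le_trans (H N).
by rewrite normrM normfV normr_nat ler_piMr// invf_le1// ler1n.
Qed.

Lemma expgrowth_delay (b : nat -> R) :
  expgrowth b -> expgrowth (fun N => if N is l.+1 then b l else 0).
Proof.
move=> [K [q H]].
exists (`|K| * (`|q| + 1)^-1), (`|q| + 1) => -[|N].
  by rewrite normr0 mulr_ge0 ?exprn_ge0 ?addr_ge0// invr_ge0 addr_ge0.
have q0 : 0 < `|q| + 1 by rewrite ltr_wpDl.
rewrite exprS -mulrA mulKf ?lt0r_neq0//.
apply: le_trans (H N) _; apply: le_trans (ler_norm _) _.
by rewrite normrM normrX ler_wpM2l// lerXn2r ?nnegrE ?(ltW q0)// lerDl.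
Qed.

Lemma expser_shift0 (b : nat -> R) t : expgrowth b ->
  t * expser (fun l => b l / l.+1%:R) t = expser (fun N => if N is l.+1 then b l else 0) t.
Proof.
move=> gb; have gb' := expgrowth_divS gb.
have gs := expgrowth_delay gb.
have c1 := @is_cvg_expser _ _ t gb'.
apply/esym/cvg_lim => //; rewrite -cvg_shiftS.
rewrite (_ : [sequence _]_n = fun N => t * series (fun l => t ^+ l / l`!%:R * (b l / l.+1%:R)) N).
  by apply: cvgM => //; exact: cvg_cst.
apply/funext => N; rewrite !seriesEord /= big_ord_recl mulr0 add0r mulr_sumr.
apply: eq_bigr => l _ /=; rewrite /bump /= add1n exprS factS natrM invfM.
by ring.
Qed.

Lemma mxXZ k (a : R) (M : 'M[R]_k) N : (a *: M) ^+ N = a ^+ N *: M ^+ N.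
Proof.
elim: N => [|N IH]; first by rewrite !expr0 scale1r.
by rewrite !exprS IH -[LHS]/(_ *m _) -scalemxAl -scalemxAr scalerA.
Qed.

Lemma phi_mxE k (M : 'M[R]_k) t i j :
  phi_mx (t *: M) i j = expser (fun l => (M ^+ l) i j / l.+1%:R) t.
Proof.
pose L := \matrix_(i, j) expser (fun l => (M ^+ l) i j / l.+1%:R) t.
suff : phi_mx (t *: M) = L by move=> ->; rewrite mxE.
apply: cvg_lim => //.
apply: cvg_mx => a b; rewrite /L mxE /expser.
have c1 := @is_cvg_expser _ _ t (expgrowth_divS (expgrowth_mxX M a b)).
rewrite (_ : (fun N => _) = series (fun N => t ^+ N / N`!%:R * ((M ^+ N) a b / N.+1%:R)))//.
apply/funext => N; rewrite !seriesEord /= summxE; apply: eq_bigr => l _.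
by rewrite !mxE mxXZ mxE /phi_coef factS natrM invfM; ring.
Qed.

End MatrixSeries.

(** * A linear differential system *)

Section ODE.
Context {R : realType}.
Implicit Types (t : R).

Lemma phi_solE k (H : 'M[R]_k) t i j :
  t * phi_mx (- t *: H) i j = expser (fun N => if N is l.+1 then ((- H) ^+ l) i j else 0) t.
Proof.
by rewrite scaleNr -scalerN phi_mxE expser_shift0//; exact: expgrowth_mxX.
Qed.

(** The columns of U(t) = t phi(- t H) solve U' = 1 - H U. *)
Lemma is_derive_phi_sol k (H : 'M[R]_k) t i j :
  is_derive t (1 : R) (fun t => t * phi_mx (- t *: H) i j)
    ((i == j)%:R - \sum_l H i l * (t * phi_mx (- t *: H) l j)).
Proof.
pose a i N := if N is l.+1 then ((- H) ^+ l) i j else 0.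
have ga i' : expgrowth (a i') by exact: expgrowth_delay (expgrowth_mxX _ _ _).
rewrite (_ : (fun t => _) = expser (a i)); last by apply/funext => s; exact: phi_solE.
apply: is_derive_eq; first exact: is_derive_expser.
under eq_bigr do rewrite phi_solE -/(a _).
rewrite (_ : (fun N => a i N.+1) = fun N =>
    (if N is 0 then (i == j)%:R else 0) + \sum_l (- H i l) * a l N); last first.
  apply/funext => -[|N] /=.
    rewrite expr0 mxE big1 ?addr0// => l _; exact: mulr0.
  rewrite exprS add0r -[LHS]/((_ *m _) i j) mxE.
  by apply: eq_bigr => l _; rewrite mxE.
have gd : expgrowth (fun N => if N is 0 then (i == j)%:R else 0 : R).
  exists 1, 1 => -[|N]; rewrite expr1n mulr1 ?normr0//.
  by case: (_ == _); rewrite ?normr1 ?normr0.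
have gZ l : expgrowth (fun N => - H i l * a l N) by exact: expgrowthZ.
rewrite expserD//; last exact: expgrowth_sum.
rewrite expser_delta expser_sum//; congr (_ + _); rewrite -sumrN.
by apply: eq_bigr => l _; rewrite expserZ// mulNr.
Qed.

(** The generating function Y of the geometric sums of B solves
    Y' = exp + B Y, because S_(N+1) = 1 + B S_N.  Multiplying by exp (- c t)
    absorbs the shift between B and c (1 - B). *)
Lemma is_derive_geosum_sol k (B : 'M[R]_k) (c : R) t i j : c != 0 ->
  let W i t := c^-1 * expR (- (c * t)) * expser (fun N => geosum B N i j) (c * t) in
  is_derive t (1 : R) (W i) ((i == j)%:R - \sum_l (c *: (1%:M - B)) i l * W l t).
Proof.
move=> c0 W.
pose g i := expser (fun N => geosum B N i j).
have dg x : is_derive x (1 : R) (g i) ((i == j)%:R * expR x + \sum_l B i l * g l x).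
  apply: is_derive_eq; first exact: (is_derive_expser _ (expgrowth_geosum B i j)).
  rewrite (_ : (fun N => _) = fun N =>
    (i == j)%:R * 1 ^+ N + \sum_l B i l * geosum B N l j); last first.
    by apply/funext => N /=; rewrite -/(geosum B N) !mxE expr1n mulr1.
  have g1 : expgrowth (fun N => 1 ^+ N : R) by exists 1, 1 => N; rewrite expr1n mulr1 normr1.
  have gZ l : expgrowth (fun N => B i l * geosum B N l j).
    by apply: expgrowthZ; exact: expgrowth_geosum.
  rewrite expserD//; [|exact: expgrowthZ|exact: expgrowth_sum].
  rewrite expserZ// expser_exp mulr1 expser_sum//; congr (_ + _).
  by apply: eq_bigr => l _; rewrite expserZ//; exact: expgrowth_geosum.
have dl : is_derive t (1 : R) (fun t => c * t) c.
  by apply: is_derive_eq; rewrite /GRing.scale /= mulr1.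
have dN : is_derive t (1 : R) (fun t => - (c * t)) (- c) by exact: is_deriveN.
have d1 : is_derive t (1 : R) (fun t => expR (- (c * t))) (expR (- (c * t)) * - c).
  exact: (@is_derive1_comp _ expR (fun t => - (c * t))).
have d2 : is_derive t (1 : R) (fun t => g i (c * t))
    (((i == j)%:R * expR (c * t) + \sum_l B i l * g l (c * t)) * c).
  exact: (@is_derive1_comp _ (g i) (fun t => c * t)).
have -> : W i = c^-1 *: ((fun t => expR (- (c * t))) * (fun t => g i (c * t))).
  by apply/funext => s; rewrite /W /= -mulrA.
apply: is_derive_eq; rewrite /GRing.scale /=.
have eE : expR (c * t) = (expR (- (c * t)))^-1 by rewrite expRN invrK.
have e0 : expR (- (c * t)) != 0 by rewrite gt_eqF ?expR_gt0.
have -> : \sum_l (c *: (1%:M - B)) i l * W l t =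
    expR (- (c * t)) * (g i (c * t) - \sum_l B i l * g l (c * t)).
  have -> : g i (c * t) = \sum_l (i == l)%:R * g l (c * t).
    rewrite (bigD1 i)//= eqxx mul1r big1 ?addr0// => l li.
    by rewrite eq_sym (negPf li) mul0r.
  rewrite -sumrB mulr_sumr; apply: eq_bigr => l _.
  by rewrite !mxE /W -/(g l); field.
by rewrite eE; field; rewrite c0 e0.
Qed.

(** The squared Euclidean norm of D does not increase, by accretivity of H. *)
Lemma linear_ode_unique k (H : 'M[R]_k) (D : 'I_k -> R -> R) :
  (forall x : 'cV[R]_k, 0 <= (x^T *m H *m x) 0 0) ->
  (forall i t, is_derive t (1 : R) (D i) (- \sum_l H i l * D l t)) ->
  (forall i, D i 0 = 0) -> forall i t, 0 <= t -> D i t = 0.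
Proof.
move=> Hpos dD D0 i t; rewrite le_eqVlt => /predU1P[<-//|t0].
pose E : R -> R := \sum_(i < k) D i ^+ 2.
have EE s : E s = \sum_(i < k) D i s ^+ 2.
  by rewrite /E fct_sumE; apply: eq_bigr => l _.
have dE s : is_derive s (1 : R) E (- 2 * \sum_a \sum_b D a s * H a b * D b s).
  apply: is_derive_eq; rewrite /GRing.scale /= mulr_sumr; apply: eq_bigr => a _.
  rewrite expr1 mulrN mulNr -mulrA; congr (- (_ * _)).
  by rewrite mulr_sumr; apply: eq_bigr => b _; rewrite mulrA.
have dE0 s : E^`()%classic s <= 0.
  rewrite derive1E derive_val mulNr oppr_le0 mulr_ge0//.
  have := Hpos (\col_a D a s); rewrite mxE.
  rewrite exchange_big /=; apply: etrans; congr (0 <= _); apply: eq_bigr => b _.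
  by rewrite !mxE mulr_suml; apply: eq_bigr => a _; rewrite !mxE.
have cE : continuous E.
  by move=> s; apply/differentiable_continuous/derivable1_diffP; exact: ex_derive.
have Et : E t <= E 0.
  apply: (@ler0_derive1_le_cc R E 0 t) => //; last exact: ltW.
  - by apply: continuous_subspaceT.
  - by rewrite in_itv /= lexx ltW.
  - by rewrite in_itv /= lexx ltW.
move: Et; rewrite !EE [leRHS]big1 => [Et|l _]; last by rewrite D0 expr0n.
have := @psumr_eq0 R 'I_k (index_enum _) xpredT (fun l => D l t ^+ 2) (fun l _ => sqr_ge0 _).
rewrite eq_le Et sumr_ge0//= => [/esym /allP /(_ i (mem_index_enum i))|l _].
  by rewrite /= expf_eq0 /= => /eqP.
exact: sqr_ge0.
Qed.

End ODE.

(** * The residual of the Krylov approximation *)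

Section Arnoldi.
Context {R : realType}.
Notation toC := (real_complex R).

Lemma mulmx_e1 m k (M : 'M[R]_(m, k)) (i0 : 'I_k) : i0 = 0%N :> nat -> M *m e1 k = col i0 M.
Proof.
move=> i00; apply/matrixP => i j; rewrite !mxE.
rewrite (bigD1 i0)//= mxE i00 eqxx mulr1 big1 ?addr0// => l li.
by rewrite mxE -i00 (inj_eq val_inj) (negPf li) mulr0.
Qed.

Lemma norm2_orthoZ n (w : 'cV[R]_n) (a : R) : w^T *m w = 1%:M -> norm2 (a *: w) = `|a|.
Proof.
move=> /matrixP /(_ 0 0); rewrite !mxE eqxx => ww.
rewrite /norm2 -[RHS]sqrtr_sqr; congr Num.sqrt.
rewrite -[RHS]mulr1 -[X in _ = _ * X]ww mulr_sumr; apply: eq_bigr => i _.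
by rewrite !mxE exprMn expr2.
Qed.

Lemma chebT_offdiag_le k (B : 'M[R]_k) (rho : R) (a b : 'I_k) n : 1 < rho -> a != b ->
  ellipse_bounded rho%:C (map_mx toC B) -> (0 < n)%N -> `|chebT B n a b| <= rho ^+ n.
Proof.
move=> rho1 ab EB n0.
have rn1 : 1 < rho ^+ n by rewrite exprn_egt1// -lt0n.
have rhoC : 1 < rho%:C by rewrite -(rmorph1 toC) ltcR.
have := chebT_ellipse_bounded rhoC n0 EB.
rewrite -map_chebT -rmorphXn => /(ellipse_bounded_orthonormal rn1) H.
have d (x y : 'I_k) : (delta_mx x 0 : 'cV[R]_k)^T *m delta_mx y 0 = (x == y)%:R%:M.
  rewrite trmx_delta mul_delta_mx_cond [LHS]mx11_scalar; congr _%:M.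
  by rewrite mulmxnE mxE !eqxx.
have := @H (delta_mx a 0) (delta_mx b 0).
rewrite !d !eqxx (negPf ab) raddf0 trmx_delta -rowE -colE !mxE.
exact.
Qed.

Lemma derive1_mulmx n k (V : 'M[R]_(n, k)) (U : R -> 'cV[R]_k) (dU : 'cV[R]_k) t :
  (forall i, is_derive t (1 : R) (fun s => U s i 0) (dU i 0)) ->
  derive1 (fun s => V *m U s) t = V *m dU.
Proof.
move=> dUi.
have dV i : is_derive t (1 : R) (fun s => (V *m U s) i 0) ((V *m dU) i 0).
  rewrite (_ : (fun s => _) = \sum_(l < k) (V i l *: (fun s => U s l 0))); last first.
    by apply/funext => s; rewrite fct_sumE mxE.
  by rewrite mxE; apply: is_derive_eq.
rewrite derive1E derive_mx; last first.
  by apply/derivable_mxP => i j; rewrite ord1; exact: ex_derive.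
apply/matrixP => i j; rewrite ord1 mxE; exact: derive_val.
Qed.

Section Process.
Context (n k : nat) (A : 'M[R]_n) (c rho : R) (g : 'cV[R]_n).
Context (V : 'M[R]_(n, k + 1)) (H : 'M[R]_(k + 1, k)).
Hypothesis arn : arnoldi A g V H.

Lemma arnoldi_split : A *m lsubmx V = lsubmx V *m usubmx H + rsubmx V *m dsubmx H.
Proof. by rewrite (arnoldi_rel arn) -{1}[V]hsubmxK -{1}[H]vsubmxK mul_row_col. Qed.

Lemma arnoldi_isometry : dsubmx H != 0 ->
  [/\ (rsubmx V)^T *m rsubmx V = 1%:M, (rsubmx V)^T *m lsubmx V = 0 &
      dsubmx H = (rsubmx V)^T *m A *m lsubmx V].
Proof.
move=> /(arnoldi_orthoS arn) VV.
have : (row_mx (lsubmx V) (rsubmx V))^T *m row_mx (lsubmx V) (rsubmx V) = 1%:M.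
  by rewrite hsubmxK.
rewrite tr_row_mx mul_col_row scalar_mx_block => /eq_block_mx[_ _ wV ww]; split => //.
by rewrite -mulmxA arnoldi_split mulmxDr !mulmxA wV ww mul0mx mul1mx add0r.
Qed.

Definition phi_sol (i0 : 'I_k) (t : R) : 'cV[R]_k :=
  \col_i (t * phi_mx (- t *: usubmx H) i i0).

(** Substituting y = V_k U and U' = e_1 - H_k U in the residual leaves
    (V_k H_k - A V_k) U, which the Arnoldi relation reduces to one direction. *)
Lemma residualE (i0 : 'I_k) t : i0 = 0%N :> nat -> norm2 g = 1 ->
  residual A g (krylov_approx V H) t = - (rsubmx V *m (dsubmx H *m phi_sol i0 t)).
Proof.
move=> i00 g1.
have yE : krylov_approx V H = fun s => lsubmx V *m phi_sol i0 s.
  apply/funext => s; rewrite /krylov_approx -mulmxA (mulmx_e1 _ i00); congr (_ *m _).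
  by apply/matrixP => i j; rewrite !mxE.
have gE : g = lsubmx V *m e1 k by rewrite (arnoldi_start arn) g1 invr1 scale1r.
have dy : derive1 (fun s => lsubmx V *m phi_sol i0 s) t =
    lsubmx V *m (e1 k - usubmx H *m phi_sol i0 t).
  apply: derive1_mulmx => i.
  rewrite (_ : (fun s => _) = fun s => s * phi_mx (- s *: usubmx H) i i0); last first.
    by apply/funext => s; rewrite mxE.
  apply: is_derive_eq; first exact: is_derive_phi_sol.
  have e10 : e1 k i 0 = (i == i0)%:R :> R by rewrite mxE -i00 (inj_eq val_inj).
  rewrite mxE e10 [in RHS]mxE [in RHS]mxE; congr (_ - _).
  by apply: eq_bigr => l _; rewrite [phi_sol _ _ _ _]mxE.
rewrite /residual yE dy mulmxBr -gE !mulNmx !mulmxA arnoldi_split mulmxDl.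
move: (_ *m usubmx H *m _) (_ *m dsubmx H *m _) => a b.
by rewrite opprB opprD -addrA subrKC addrAC addNr add0r.
Qed.

(** The last row of the Hessenberg matrix has one nonzero entry, namely
    v_(k+1)^T A v_k, and v_(k+1) is orthogonal to v_k: the bound for orthonormal
    vectors applies to it, after the identity in 1 - A / c drops out. *)
Lemma norm2_residual_le (i0 il : 'I_k) t : i0 = 0%N :> nat -> il.+1 = k -> (0 < il)%N ->
  norm2 g = 1 -> 0 < c -> 1 < rho ->
  ellipse_bounded rho%:C (map_mx toC (1%:M - c^-1 *: A)) ->
  norm2 (residual A g (krylov_approx V H) t) <= c * rho * `|phi_sol i0 t il 0|.
Proof.
move=> i00 ilk il0 g1 c0 rho1 EA.
have rho0 : 0 < rho := lt_trans ltr01 rho1.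
rewrite (residualE _ i00 g1).
have [->|/arnoldi_isometry[ww wV hE]] := eqVneq (dsubmx H) 0.
  rewrite mul0mx mulmx0 oppr0 /norm2 big1 ?sqrtr0 ?mulr_ge0 ?(ltW c0) ?(ltW rho0)// => i _.
  by rewrite mxE expr0n.
have hU : dsubmx H *m phi_sol i0 t = (dsubmx H 0 il * phi_sol i0 t il 0)%:M.
  rewrite [LHS]mx11_scalar; congr _%:M; rewrite mxE (bigD1 il)//= big1 ?addr0// => l lil.
  rewrite [dsubmx H 0 l]mxE (arnoldi_hess arn) ?mul0r//=.
  rewrite addn0 -[X in (_ < X)%N]ilk ltnS ltn_neqAle (inj_eq val_inj) lil /=.
  by rewrite -ltnS ilk.
rewrite hU mul_mx_scalar -scaleNr norm2_orthoZ// normrN normrM ler_wpM2r//.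
pose v := lsubmx V *m (delta_mx il 0 : 'cV[R]_k).
have vv : v^T *m v = 1%:M.
  rewrite trmx_mul mulmxA -(mulmxA _ _ (lsubmx V)) (arnoldi_ortho arn) mulmx1.
  by rewrite trmx_delta mul_delta_mx [LHS]mx11_scalar mxE eqxx.
have wv : (rsubmx V)^T *m v = 0 by rewrite mulmxA wV mul0mx.
have := ellipse_bounded_orthonormal rho1 EA ww vv wv.
rewrite mulmxBr mulmxBl mulmx1 wv sub0r -scalemxAr -scalemxAl.
rewrite hE /v mulmxA -colE ![in X in X -> _]mxE normrN normrM normfV (gtr0_norm c0).
by rewrite ler_pdivrMl// [in X in _ -> X]mxE.
Qed.

End Process.

End Arnoldi.

(** * The residual bound *)

Section MatrixFunctionODE.
Context {R : realType}.
Notation toC := (real_complex R).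

Lemma qform_real n (M : 'M[R]_n) (x : 'cV[R]_n) :
  complex.Re (qform M (map_mx toC x)) = (x^T *m M *m x) 0 0.
Proof.
have := qform_rect M x 0; rewrite map_mx0 scaler0 addr0 => -> /=.
by rewrite mulmx0 [X in _ + X]mxE addr0.
Qed.

(** Both sides solve the same linear system with initial value 0. *)
Lemma phi_sol_geosum k (Hk : 'M[R]_k) (c t : R) i j : 0 < c -> 0 <= t ->
  (forall x : 'cV[R]_k, 0 <= (x^T *m Hk *m x) 0 0) ->
  t * phi_mx (- t *: Hk) i j =
    c^-1 * expR (- (c * t)) * expser (fun N => geosum (1%:M - c^-1 *: Hk) N i j) (c * t).
Proof.
move=> c0 t0 Hpos; set B := _ - _.
have c0' : c != 0 by rewrite gt_eqF.
have HB : Hk = c *: (1%:M - B).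
  by rewrite /B opprB addrCA subrr addr0 scalerA divff// scale1r.
pose u l s := s * phi_mx (- s *: Hk) l j.
pose w l s := c^-1 * expR (- (c * s)) * expser (fun N => geosum B N l j) (c * s).
have dD l s : is_derive s (1 : R) (u l - w l) (- \sum_m Hk l m * (u m - w m) s).
  apply: is_derive_eq.
    apply: is_deriveB; first exact: is_derive_phi_sol.
    exact: (is_derive_geosum_sol B s l j c0').
  rewrite -HB opprD opprK addrACA subrr add0r addrC -opprB -sumrB; congr (- _).
  by apply: eq_bigr => m _; rewrite -mulrBr.
have D0 l : (u l - w l) 0 = 0.
  rewrite -[LHS]/(u l 0 - w l 0) /u /w mul0r mulr0 sub0r.
  have -> : expser (fun N => geosum B N l j) 0 = 0.
    rewrite -[RHS](expser_delta 0 0); congr (limn (series _)); apply/funext => -[|N].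
      by rewrite mxE.
    by rewrite expr0n /= !mul0r.
  by rewrite mulr0 oppr0.
have := linear_ode_unique Hpos dD D0 i t0.
by move/eqP; rewrite subr_eq0 => /eqP.
Qed.

End MatrixFunctionODE.

Theorem proposition4p6 (R : realType) (n k : nat) (A : 'M[R]_n) (c rho : R)
    (g : 'cV[R]_n) (V : 'M[R]_(n, k + 1)) (H : 'M[R]_(k + 1, k)) (t : R) :
  (forall z : 'cV[R[i]]_n, 0 <= complex.Re (qform A z)) ->
  0 < c -> 1 < rho ->
  enclosed_by_ellipse (numrange A) 0 (2 * c)%:C (rho * c) ->
  norm2 g = 1 ->
  0 <= t ->
  (2 <= k)%N ->
  arnoldi A g V H ->
  ((norm2 (residual A g (krylov_approx V H) t))%:E <=
   (4 * expR (- (c * t)))%:E *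
   \sum_(k <= nu <oo)
     (((nu - k + 2) * (nu - k + 1))%:R * rho ^+ nu * besselI nu (c * t))%:E)%E.
Proof.
move=> Apos c0 rho1 encl g1 t0 k2 arn.
have k0 : (0 < k)%N by exact: ltnW.
have kp : (k.-1 < k)%N by rewrite prednK.
pose i0 := Ordinal k0; pose il := Ordinal kp.
have i00 : i0 = 0%N :> nat by [].
have ilk : il.+1 = k by rewrite /= prednK.
have il0 : (0 < il)%N by rewrite -ltnS ilk.
have rho0 : 0 < rho := lt_trans ltr01 rho1.
have EA := ellipse_bounded_shift c0 rho1 encl.
pose Vk := lsubmx V; pose Hk := usubmx H.
have HkE : Hk = Vk^T *m A *m Vk by exact: arnoldi_proj arn.
pose B := 1%:M - c^-1 *: Hk.
have EB : ellipse_bounded rho%:C (map_mx (real_complex R) B).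
  have := ellipse_bounded_isometry (arnoldi_ortho arn) EA.
  rewrite mulmxBr mulmxBl mulmx1 (arnoldi_ortho arn) -scalemxAr -scalemxAl.
  by rewrite -(arnoldi_proj arn).
have Hpos (x : 'cV[R]_k) : 0 <= (x^T *m Hk *m x) 0 0.
  have := Apos (map_mx (real_complex R) (Vk *m x)).
  by rewrite qform_real trmx_mul HkE !mulmxA.
have bB : band 1 B.
  move=> i j ij.
  have Hz : Hk i j = 0.
    by rewrite /Hk mxE; apply: (arnoldi_hess arn); rewrite /= -addn1.
  have ij' : (i == j) = false.
    by apply/negbTE/eqP => E; move: ij; rewrite E addn1 ltnNge leqnSn.
  by rewrite /B [LHS]mxE mxE ij' mxE mxE Hz mulr0 subr0.
have bT m : (0 < m)%N -> `|chebT B m il i0| <= rho ^+ m.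
  by apply: chebT_offdiag_le => //; rewrite -(inj_eq val_inj) /= -lt0n.
have x0 : 0 <= c * t by rewrite mulr_ge0// ltW.
set S := (\sum_(k <= nu <oo) _)%E.
have S0 : (0 <= S)%E.
  apply: nneseries_ge0 => nu _ _; rewrite lee_fin.
  by rewrite !mulr_ge0 ?exprn_ge0 ?(ltW rho0) ?besselI_ge0.
have key := lim_exp_series_le rho0 x0 (fun N => geosum_corner N bB i00 ilk il0 (ltW rho1) bT)
  (@is_cvg_expser _ _ (c * t) (expgrowth_geosum B il i0)).
rewrite -/S -/(expser _ _) in key.
set F := expser _ _ in key.
have E0 : 0 < expR (- (c * t)) by exact: expR_gt0.
apply: (@le_trans _ _ (expR (- (c * t)) * (`|F| * rho))%:E).
  rewrite lee_fin.
  apply: le_trans (norm2_residual_le arn t i00 ilk il0 g1 c0 rho1 EA) _.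
  rewrite mxE (phi_sol_geosum il i0 c0 t0 Hpos) -/B -/F.
  rewrite !normrM normfV (gtr0_norm c0) (gtr0_norm E0).
  rewrite le_eqVlt; apply/orP; left; apply/eqP; field; exact: lt0r_neq0.
rewrite [in leLHS]EFinM (_ : (4 * _)%:E = ((expR (- (c * t)))%:E * 4%:E)%E); last first.
  by rewrite -EFinM mulrC.
rewrite -muleA.
apply: lee_wpmul2l; first by rewrite lee_fin ltW.
apply: le_trans key _; apply: lee_wpmul2r => //.
by rewrite lee_fin ler_nat.
Qed.
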